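(* Let $M\ge2$ be an integer and $p\in[0,1]$ with $Mp>1$. Let $F_1,F_2$ be two independent copies of the Mandelbrot percolation set $F$ with parameters $M$ and $p$. Then, conditional on $F_1\ne\emptyset$ and $F_2\neq\emptyset$: (i) $\dim_{\rm H}F_1+\dim_{\rm H}F_2<1$ implies that $F_2-F_1$ almost surely contains no interval; (ii) $\dim_{\rm H}F_1+\dim_{\rm H}F_2>1$ implies that $F_2-F_1$ almost surely contains an interval.
   Context: Mandelbrot percolation with parameters $M,p$: to every finite string $i_1\dots i_n$, $n\ge 1$, $i_k\in\{0,\dots,M-1\}$, attach a label $X_{i_1\dots i_n}$; the labels are i.i.d. Bernoulli random variables taking the value $1$ with probability $p$ and $0$ with probability $1-p$. Put $$I_{i_1\dots i_n}=\Big[\sum_{k=1}^n\frac{i_k}{M^k},\ \sum_{k=1}^n\frac{i_k}{M^k}+\frac1{M^n}\Big],\qquad S_n=\{i_1\dots i_n: X_{i_1}=X_{i_1i_2}=\dots=X_{i_1\dots i_n}=1\},$$ $F^n=\bigcup_{i_1\dots i_n\in S_n}I_{i_1\dots i_n}$ and $F=\bigcap_{n\ge1}F^n\subset[0,1]$. $\dim_{\rm H}$ denotes Hausdorff dimension; it is a known fact that, almost surely on $F\ne\emptyset$, $\dim_{\rm H}F=\log(Mp)/\log M$, so the dimension conditions are (almost surely, given non-emptiness) conditions on the deterministic parameters. The algebraic difference is $F_2-F_1=\{x_2-x_1:x_1\in F_1,\ x_2\in F_2\}$. ''Interval'' means a nondegenerate interval (of positive length). *)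

(* Defs.v *)
From HB Require Import structures.
From mathcomp Require Import all_boot all_order all_algebra.
From mathcomp Require Import all_classical all_reals all_analysis.

Set Implicit Arguments.
Unset Strict Implicit.
Unset Printing Implicit Defensive.

Import Order.TTheory GRing.Theory Num.Theory.

Local Open Scope classical_set_scope.
Local Open Scope ring_scope.

Section hausdorff_dimension.
Context {R : realType}.
Local Open Scope ereal_scope.
Implicit Types A U : set R.

(* Equal to -oo on the empty set. *)
Definition diam U : \bar R :=
  ereal_sup [set (`|x.1 - x.2|%R)%:E | x in U `*` U].

(* |U|^s, with |set0|^s = 0 and, for U nonempty, |U|^0 = 1. *)
Definition diam_pow (s : R) U : \bar R :=
  if U == set0 then 0 else poweR (diam U) s.

Definition hausdorff_content (s delta : R) A : \bar R :=
  ereal_inf [set \sum_(0 <= i <oo) diam_pow s (U i) |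
    U in [set U : nat -> set R |
      A `<=` \bigcup_i U i /\ forall i, diam (U i) <= delta%:E]].

Definition hausdorff_measure (s : R) A : \bar R :=
  ereal_sup [set hausdorff_content s delta A |
    delta in [set delta : R | (0 < delta)%R]].

Definition dimH A : \bar R :=
  ereal_inf [set s%:E |
    s in [set s : R | (0 <= s)%R /\ hausdorff_measure s A = 0]].

End hausdorff_dimension.

(* Every nondegenerate interval contains a compact nondegenerate one, so
   compact intervals suffice. *)
Definition contains_interval {R : realType} (A : set R) : Prop :=
  exists a b : R, a < b /\ `[a, b] `<=` A.

Definition algebraic_difference {R : realType} (A2 A1 : set R) : set R :=
  [set x2 - x1 | x2 in A2 & x1 in A1].

Section independence.
Context {d d'} {T : measurableType d} {T' : measurableType d'} {R : realType}
  (P : probability T R).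

(* Mutual independence of the subfamily of X indexed by D. *)
Definition mutually_independent {I : choiceType} (D : set I)
    (X : I -> {RV P >-> T'}) : Prop :=
  forall (s : seq I) (A : I -> set T'),
    uniq s -> [set` s] `<=` D -> (forall i, measurable (A i)) ->
    P (\bigcap_(i in [set` s]) (X i @^-1` A i)) =
    (\prod_(i <- s) P (X i @^-1` A i))%E.

Definition generated_sigma_algebra {I : Type} (D : set I)
    (X : I -> {RV P >-> T'}) : set (set T) :=
  <<s \bigcup_(i in D) g_sigma_algebra_preimage (X i) >>.

Definition independent_families {I : Type} (D : set I)
    (X1 X2 : I -> {RV P >-> T'}) : Prop :=
  forall A1 A2 : set T,
    generated_sigma_algebra D X1 A1 -> generated_sigma_algebra D X2 A2 ->
    P (A1 `&` A2) = (P A1 * P A2)%E.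

End independence.

Section mandelbrot_percolation.
Context {d} {T : measurableType d} {R : realType} {P : probability T R}
  {M : nat}.

(* Digit strings i_1 ... i_n with n >= 1; the label that a family indexed by
   seq 'I_M attaches to the empty string is never used. *)
Definition strings : set (seq 'I_M) := [set u | u != [::]].

Definition percolation_labels (p : R) (X : seq 'I_M -> {RV P >-> bool}) : Prop :=
  (forall u, strings u -> distribution P (X u) =1 bernoulli_prob p) /\
  mutually_independent strings X.

(* Digit i_k is tnth i (k - 1). *)
Definition left_endpoint n (i : n.-tuple 'I_M) : R :=
  \sum_(k < n) (tnth i k)%:R / M%:R ^+ k.+1.

Definition level_interval n (i : n.-tuple 'I_M) : set R :=
  `[left_endpoint i, left_endpoint i + (M%:R ^+ n)^-1].

Context (X : seq 'I_M -> {RV P >-> bool}).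

Definition retained (w : T) n : set (n.-tuple 'I_M) :=
  [set i : n.-tuple 'I_M | forall k, (0 < k <= n)%N ->
    X (take k i) w = true].

Definition percolation_level (w : T) (n : nat) : set R :=
  \bigcup_(i in @retained w n) level_interval i.

Definition percolation_set (w : T) : set R :=
  \bigcap_(n in [set n | (0 < n)%N]) percolation_level w n.

End mandelbrot_percolation.

(* Main.v *)
Require Import Defs.
From HB Require Import structures.
From mathcomp Require Import all_boot all_order all_algebra.
From mathcomp Require Import all_classical all_reals all_analysis.
From mathcomp Require Import ring lra zify.

Set Implicit Arguments.
Unset Strict Implicit.
Unset Printing Implicit Defensive.

Import Order.TTheory GRing.Theory Num.Theory.

Local Open Scope classical_set_scope.
Local Open Scope ring_scope.

(** Why the theorem holds.

    Almost surely on survival both percolation sets have dimension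
    log (M p) / log M, so the hypotheses compare 2 log (M p) / log M with 1,
    that is, [M * p ^+ 2] with 1.  Only the comparison of each dimension with
    1/2 is needed: the dimension is almost surely at least 1/2 if
    [M * p ^+ 2 >= 1] ([dimH_ge_half_ae]) and at most 1/2 if [M * p ^+ 2 <= 1]
    ([dimH_le_half_ae]).  Hence, up to null events, (i) is vacuous unless
    [M * p ^+ 2 < 1] and (ii) is vacuous unless [M * p ^+ 2 > 1].

    Let Z_1 and Z_2 be the numbers of surviving strings of length n.
    If [M * p ^+ 2 < 1], the difference set is covered by Z_1 Z_2 intervals of
    length 2 / M^n, of expected total length 2 (M p^2)^n, and this tends to 0
    ([no_interval_ae]).

    If [M * p ^+ 2 > 1], count the pairs (x, x + k) of surviving level n cells
    with difference k, the column of k.  Pairs in one column use distinct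
    cells of either percolation, so given level n the size of column M k + l
    of level n + 1 is binomial with parameter p^2 and (M - l) C(k) + l C(k + 1)
    trials, C being the column sizes of level n.  If columns k and k + 1 have
    at least N pairs, all columns between M k and M (k + 1) expect at least
    (M p^2) N pairs, and the chance of a column falling below N plus a constant
    is exponentially small in N.  Starting from a level where all labels are
    open, with positive probability all M^m + 1 columns descending from two
    adjacent ones stay nonempty for ever, and the difference set then contains
    an interval, as infinite branches of pairs show ([interval_of_columns]).

    The upper bound on the dimension is a first moment computation
    ([hausdorff_measure0_ae]).  For the lower bound, thin the surviving tree
    again, keeping each node with probability q = M^-s.  The probability that
    the thinned tree survives is at most the sum of q^k over the levels k of the
    nodes of any cut, and a cover of the limit set by small sets yields a cut
    with a comparable sum of s-th powers of diameters ([cover_lower_bound]).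
    On average the thinned tree is a percolation of parameter p q, which
    survives with positive probability if M p q > 1 ([expect_persist]).

    Positive probability becomes probability one given survival
    ([zero_one_ae]): a surviving supercritical tree has many nodes at deep
    levels, below which the subtrees give independent trials.  In terms of the
    generating function G of the offspring law this says that the iterates of
    G at any x < 1 and at 0 merge ([iter_gw_gap]).

    Probabilities are only ever computed for events that read finitely many
    labels, as explicit averages ([expect], [event_prob]); strings are coded
    by numerals, so that the nodes of level n are the numbers below M^n. *)

(** * Averages over finitely many Bernoulli labels *)

Section expectation.
Context {R : realFieldType} {I : eqType} (p : R).
Implicit Types (e : I -> bool) (s t : seq I) (i j : I).
Implicit Types Phi Psi : (I -> bool) -> R.

Definition upd e i (c : bool) : I -> bool := fun j => if j == i then c else e j.

Lemma upd_same e i c : upd e i c i = c.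
Proof. by rewrite /upd eqxx. Qed.

Lemma upd_other e i c j : j != i -> upd e i c j = e j.
Proof. by rewrite /upd => /negPf ->. Qed.

(** Replacing the labels listed in [s] by fresh independent ones and averaging:
    an expectation over a finite product space that leaves the other labels
    as parameters, so it serves as a conditional expectation too.  Its steps
    commute and are idempotent, hence [expect p s] depends on [s] only as a set
    (see [expect_absorb]) and the lists may contain repetitions. *)
Fixpoint expect s Phi e : R :=
  if s is i :: s' then
    p * expect s' Phi (upd e i true) + (1 - p) * expect s' Phi (upd e i false)
  else Phi e.

(** Measurability with respect to the labels in [s]. *)
Definition supported {V : Type} s (Phi : (I -> bool) -> V) :=
  forall e e', {in s, e =1 e'} -> Phi e = Phi e'.

Lemma upd_upd e i c d : upd (upd e i c) i d = upd e i d.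
Proof. by apply/funext => j; rewrite /upd; case: eqP. Qed.

Lemma updC e i j c d : i != j -> upd (upd e i c) j d = upd (upd e j d) i c.
Proof.
move=> ij; apply/funext => k; rewrite /upd.
by case: (eqVneq k j) => [->|//]; rewrite eq_sym (negPf ij).
Qed.

Lemma expect_cat s t Phi e : expect (s ++ t) Phi e = expect s (expect t Phi) e.
Proof. by elim: s e => //= i s IH e; rewrite !IH. Qed.

(** Only configurations that agree with [e] off [s] are averaged; this is what
    allows quantities of earlier levels to be treated as constants. *)
Lemma eq_expect s Phi Psi e :
  (forall e', (forall j, j \notin s -> e' j = e j) -> Phi e' = Psi e') ->
  expect s Phi e = expect s Psi e.
Proof.
elim: s e => [|i s IH] e H /=; first exact: H.
rewrite !IH // => e' He'; apply: H => j; rewrite inE negb_or => /andP[ji js];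
  by rewrite He' // /upd (negPf ji).
Qed.

Lemma expectD s Phi Psi e :
  expect s (fun e' => Phi e' + Psi e') e = expect s Phi e + expect s Psi e.
Proof. by elim: s e => //= i s IH e; rewrite !IH; ring. Qed.

Lemma expectZ s a Phi e :
  expect s (fun e' => a * Phi e') e = a * expect s Phi e.
Proof. by elim: s e => //= i s IH e; rewrite !IH; ring. Qed.

Lemma expect_cst s a e : expect s (fun=> a) e = a.
Proof. by elim: s e => //= i s IH e; rewrite !IH; ring. Qed.

Lemma expect_sum (J : Type) (r : seq J) (F : J -> (I -> bool) -> R) s e :
  expect s (fun e' => \sum_(k <- r) F k e') e = \sum_(k <- r) expect s (F k) e.
Proof.
elim: r => [|k r IH].
  by rewrite big_nil -[RHS](expect_cst s 0 e); apply: eq_expect => e' _;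
     rewrite big_nil.
rewrite big_cons -IH -expectD; apply: eq_expect => e' _; exact: big_cons.
Qed.

Lemma expect1_comm i s Phi e :
  expect s (expect [:: i] Phi) e = expect [:: i] (expect s Phi) e.
Proof.
elim: s e => //= j s IH e; rewrite !IH /=.
have [->|ij] := eqVneq j i; first by rewrite !upd_upd; ring.
by rewrite !(updC _ _ _ ij); ring.
Qed.

Lemma expect_mem i s Phi e :
  i \in s -> expect s (expect [:: i] Phi) e = expect s Phi e.
Proof.
elim: s e => //= j s IH e; rewrite inE => /orP[/eqP <-|/IH {}IH]; last first.
  by rewrite !IH.
by rewrite !expect1_comm /= !upd_upd; ring.
Qed.

(** Tower property. *)
Lemma expect_absorb s t Phi e : {subset s <= t} ->
  expect t (expect s Phi) e = expect t Phi e.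
Proof.
elim: s Phi e => //= i s IH Phi e st.
rewrite -(IH Phi); last by move=> j js; apply: st; rewrite inE js orbT.
rewrite -[RHS](expect_mem (i := i)) //; exact/st/mem_head.
Qed.

Lemma expect_supported s t Phi e e' : supported t Phi ->
  (forall j, j \in t -> j \notin s -> e j = e' j) ->
  expect s Phi e = expect s Phi e'.
Proof.
move=> H; elim: s e e' => [|i s IH] e e' He /=.
  by apply: H => j jt; apply: He.
by congr (_ * _ + _ * _); apply: IH => j jt js; rewrite /upd;
   case: eqVneq => // ji; apply: He => //; rewrite inE negb_or ji.
Qed.

Lemma supported_sub (V : Type) s t (Phi : (I -> bool) -> V) :
  {subset s <= t} -> supported s Phi -> supported t Phi.
Proof. by move=> st H e e' He; apply: H => j /st; apply: He. Qed.

(** Averaging further labels, or starting from another configuration, is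
    harmless once every label that [Phi] reads is averaged. *)
Lemma expect_sub s t Phi e e' : supported s Phi -> {subset s <= t} ->
  expect t Phi e = expect s Phi e'.
Proof.
move=> H st; rewrite -(expect_absorb _ _ st) -[RHS](expect_cst t _ e).
apply: eq_expect => e'' _; apply: (expect_supported H) => j js.
by rewrite js.
Qed.

(** Independence of functions that read disjoint groups of labels. *)
Lemma expect_blocks (C : eqType) (cs : seq C) (blk : C -> seq I)
    (Phi : C -> (I -> bool) -> R) t e :
  uniq cs ->
  {in cs, forall c, supported (blk c) (Phi c)} ->
  {in cs &, forall c c' j, j \in blk c -> j \in blk c' -> c = c'} ->
  {in cs, forall c, {subset blk c <= t}} ->
  expect t (fun e' => \prod_(c <- cs) Phi c e') e =
  \prod_(c <- cs) expect (blk c) (Phi c) e.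
Proof.
elim: cs => [|c cs IH] /=.
  move=> _ _ _ _; rewrite big_nil -[RHS](expect_cst t _ e).
  by apply: eq_expect => e' _; rewrite big_nil.
move=> /andP[ccs ucs] Hs Hd Ht.
have Hs' : {in cs, forall c, supported (blk c) (Phi c)}.
  by move=> c' h; apply: Hs; rewrite inE h orbT.
have Hd' : {in cs &, forall c c' j, j \in blk c -> j \in blk c' -> c = c'}.
  by move=> a b ha hb; apply: Hd; rewrite inE ?ha ?hb orbT.
have Ht' : {in cs, forall c, {subset blk c <= t}}.
  by move=> c' h; apply: Ht; rewrite inE h orbT.
have hc := mem_head c cs.
rewrite big_cons -IH // -[LHS](expect_absorb _ _ (Ht c hc)) -expectZ.
have K e1 : expect (blk c) (fun e' => \prod_(c0 <- c :: cs) Phi c0 e') e1 =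
    (\prod_(c0 <- cs) Phi c0 e1) * expect (blk c) (Phi c) e1.
  rewrite -(expectZ (blk c)); apply: eq_expect => e' He'.
  rewrite big_cons mulrC; congr (_ * _); apply: eq_big_seq => c' c'cs.
  apply: (Hs' _ c'cs) => j jc'; apply: He'; apply/negP => jc.
  have E : c = c' by apply: Hd jc jc' => //; rewrite inE c'cs orbT.
  by rewrite E c'cs in ccs.
apply: eq_expect => e1 _; rewrite K mulrC; congr (_ * _).
by apply: (expect_supported (Hs c hc)) => j ->.
Qed.

(** The single outcome in which every label of [s] is open already contributes
    [p ^+ size s].  The second hypothesis on [Phi] lets the labels off [s]
    stay equal to those of [e], which is what the induction needs. *)
Lemma expect_all_true s Phi e : 0 <= p <= 1 ->
  (forall e', 0 <= Phi e') ->
  (forall e', {in s, forall j, e' j} -> (forall j, j \notin s -> e' j = e j) ->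
     1 <= Phi e') ->
  p ^+ size s <= expect s Phi e.
Proof.
move=> /andP[p0 p1] Phi0; have ge0 t e' : 0 <= expect t Phi e'.
  by elim: t e' => //= i t IH e'; rewrite addr_ge0 // mulr_ge0 // subr_ge0.
elim: s e => [|i s IH] e H /=; first by rewrite expr0 H.
rewrite exprS -[leLHS]addr0 lerD //; last by rewrite mulr_ge0 // subr_ge0.
apply: ler_wpM2l => //; apply: IH => e' He' Ho.
have Hi : e' i.
  by case: (boolP (i \in s)) => [/He' //|/Ho ->]; rewrite /upd eqxx.
apply: H => j; first by rewrite inE => /orP[/eqP ->|/He'].
by rewrite inE negb_or => /andP[ji /Ho ->]; rewrite /upd (negPf ji).
Qed.

Lemma ler_expect s Phi Psi e : 0 <= p <= 1 ->
  (forall e', (forall j, j \notin s -> e' j = e j) -> Phi e' <= Psi e') ->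
  expect s Phi e <= expect s Psi e.
Proof.
move=> /andP[p0 p1]; elim: s e => [|i s IH] e H /=; first exact: H.
by apply: lerD; (apply: ler_wpM2l; first by rewrite ?subr_ge0);
  apply: IH => e' He'; apply: H => j; rewrite inE negb_or => /andP[ji js];
  rewrite He' // /upd (negPf ji).
Qed.

End expectation.

Arguments upd : simpl never.

(** Relabelling: a subtree has the same law as the whole tree. *)
Lemma expect_map (R : realFieldType) (I J : eqType) (p : R) (h : J -> I)
    (s : seq J) (Phi : (J -> bool) -> R) (e : I -> bool) : injective h ->
  expect p (map h s) (fun e' => Phi (e' \o h)) e = expect p s Phi (e \o h).
Proof.
move=> hI; elim: s e => //= i s IH e; rewrite !IH.
have E c : upd e (h i) c \o h = upd (e \o h) i c.
  by apply/funext => j; rewrite /upd /= (inj_eq hI).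
by rewrite !E.
Qed.

(** * The generating function of a binomial offspring law *)

Lemma le_inv_nat (R : realType) (c : R) : 0 < c -> exists k : nat, k.+1%:R^-1 <= c.
Proof.
move=> c0; have := archi_boundP (ltW (_ : 0 < c^-1)); rewrite invr_gt0 => /(_ c0) Hk.
exists (Num.bound c^-1); rewrite -[leRHS]invrK lef_pV2 ?posrE ?invr_gt0 //.
by apply/ltW/(lt_le_trans Hk); rewrite ler_nat.
Qed.

Section galton_watson.
Context {R : realType}.
Implicit Types (p s t r x : R) (n : nat).

Lemma exp_small r (eps : R) : 0 <= r < 1 -> 0 < eps ->
  exists N, forall n, (N <= n)%N -> r ^+ n <= eps.
Proof.
move=> /andP[r0 r1] e0.
have /cvg_expr/cvgrPdist_le /(_ _ e0)[N _ HN] : `|r| < 1 by rewrite ger0_norm.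
exists N => n Nn; have := HN n Nn; rewrite sub0r normrN ger0_norm //.
by rewrite exprn_ge0.
Qed.

(** Generating function of the number of open children of a node: a sum of
    [M] independent labels of parameter [p]. *)
Definition gw (M : nat) p s := (1 - p + p * s) ^+ M.

Lemma exp_sub_le n (y : R) : 0 <= y <= 1 ->
  (1 - y) ^+ n <= 1 - n%:R * y + n%:R ^+ 2 * y ^+ 2.
Proof.
move=> /andP[y0 y1]; elim: n => [|n IH]; first by rewrite expr0; nra.
rewrite exprSr; apply: (le_trans (ler_wpM2r _ IH)); first by rewrite subr_ge0.
have n0 : (0 : R) <= n%:R by rewrite ler0n.
rewrite -natr1; set k := n%:R in n0 *.
have k2 : 0 <= k ^+ 2 * y ^+ 2 * y by rewrite !mulr_ge0 ?exprn_ge0.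
by nra.
Qed.

(** The slope of [gw] at 1 is [M * p], so in the supercritical case the graph
    lies strictly below the diagonal just left of 1. *)
Lemma gw_below (M : nat) p : 0 <= p <= 1 -> 1 < M%:R * p ->
  exists2 d0, 0 < d0 <= 1 & forall d, 0 < d <= d0 -> gw M p (1 - d) < 1 - d.
Proof.
move=> /andP[p0 p1] Mp.
have M0 : 0 < M%:R :> R.
  by rewrite lt_neqAle ler0n andbT eq_sym; apply: contraTneq Mp => ->; rewrite mul0r ltr10.
set k : R := M%:R in Mp M0 *.
have k2 : 0 < k ^+ 2 by rewrite exprn_gt0.
(* by exp_sub_le, gw (1 - d) <= 1 - M p d + M^2 d^2, and M^2 d^2 < (M p - 1) d here *)
exists (Num.min 1 ((k * p - 1) / (k ^+ 2 *+ 2))).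
  rewrite lt_min ltr01 /= ge_min lexx andbT.
  by rewrite divr_gt0 ?subr_gt0 // pmulrn_lgt0.
move=> d /andP[d0]; rewrite le_min => /andP[d1].
rewrite ler_pdivlMr; last by rewrite pmulrn_lgt0.
move=> dk; rewrite /gw.
have -> : 1 - p + p * (1 - d) = 1 - p * d by ring.
apply: (le_lt_trans (exp_sub_le _ _)); first by apply/andP; split; nra.
rewrite -/k.
have H : k ^+ 2 * (p * d) ^+ 2 <= k ^+ 2 * d * d.
  have p2 : 0 <= 1 - p ^+ 2 by rewrite subr_ge0 exprn_ile1.
  by have := mulr_ge0 (exprn_even_ge0 (k * d) (isT : ~~ odd 2)) p2; nra.
have {}dk : k ^+ 2 * d * 2 <= k * p - 1 by rewrite mulr2n in dk; lra.
have : k ^+ 2 * d * d < (k * p - 1) * d by rewrite ltr_pM2r //; nra.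
by nra.
Qed.

Section iterate.
Context (M : nat) (p : R).
Hypotheses (M1 : (2 <= M)%N) (p01 : 0 <= p <= 1) (Mp : 1 < M%:R * p).
Local Notation G := (gw M p).

Lemma gw_mono s t : 0 <= s -> s <= t -> G s <= G t.
Proof.
move: p01 => /andP[p0 p1] s0 st.
by apply: lerXn2r; rewrite ?nnegrE //; nra.
Qed.

Lemma gw_ge0 s : 0 <= s -> 0 <= G s.
Proof. by move: p01 => /andP[p0 p1] s0; rewrite exprn_ge0 //; nra. Qed.

Lemma iter_gw_ge0 n s : 0 <= s -> 0 <= iter n G s.
Proof. by move=> s0; elim: n => //= n; apply: gw_ge0. Qed.

Lemma iter_gw_mono n s t : 0 <= s -> s <= t -> iter n G s <= iter n G t.
Proof.
move=> s0 st; elim: n => //= n; apply: gw_mono; exact: iter_gw_ge0.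
Qed.

(** The relative gap (t - s) / (1 - t) contracts under [gw] by a factor bounded
    away from 1 as long as [t] stays below [r].  With a, b the bases of the
    two powers, b^M - a^M is at most M (b - a) b^(M-1), whereas 1 - b^M is
    (1 - b) times the sum of the b^k for k < M, whose term k = 0 exceeds
    b^(M-1) by a factor at least 1 / B.  The inequality is written without
    divisions. *)
Lemma gw_contract r s t B : B = 1 - p + p * r ->
  0 <= s -> s <= t -> t <= r -> r < 1 ->
  (G t - G s) * (1 - t) * (M.-1%:R * B + 1) <= M%:R * B * (t - s) * (1 - G t).
Proof.
move=> EB s0 st tr r1.
have p0 : 0 < p.
  case/andP: p01 => p0 _; rewrite lt_neqAle p0 andbT eq_sym.
  by apply: contraTneq Mp => ->; rewrite mulr0 ltr10.
have p1 : p <= 1 by case/andP: p01.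
rewrite /gw; set a := 1 - p + p * s; set b := 1 - p + p * t.
have a0 : 0 <= a by rewrite /a; nra.
have ab : a <= b by rewrite /a /b; nra.
have bB : b <= B by rewrite /b EB; nra.
have B1 : B < 1 by rewrite EB; nra.
have b0 := le_trans a0 ab.
clear Mp; case: M M1 => [|[|m]] //= _.
set u := b ^+ m.+1.
have u0 : 0 <= u by rewrite exprn_ge0.
have uB : u <= B.
  by rewrite /u exprS (le_trans _ bB) // ler_piMr // exprn_ile1 //; lra.
have Ha : b ^+ m.+2 - a ^+ m.+2 <= (b - a) * (m.+2%:R * u).
  rewrite subrXX ler_wpM2l ?subr_ge0 //.
  rewrite mulr_natl -[in leRHS](card_ord m.+2) -sumr_const; apply: ler_sum => i _.
  rewrite /u /=.
  have im : (i <= m.+1)%N by rewrite -ltnS.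
  by rewrite -[in leRHS](subnK im) exprD ler_wpM2l ?exprn_ge0 // lerXn2r.
have Hb : (1 - b) * (m.+1%:R * u + 1) <= 1 - b ^+ m.+2.
  rewrite -[X in X - b ^+ _](expr1n _ m.+2) subrXX ler_wpM2l //; first lra.
  rewrite big_ord_recl /= expr1n mul1r expr0 addrC lerD2l.
  rewrite mulr_natl -[in leLHS](card_ord m.+1) -sumr_const; apply: ler_sum => i _.
  rewrite expr1n mul1r /u.
  by apply: ler_wiXn2l => //; lra.
(* in terms of a and b both gaps are multiplied by p *)
have -> : 1 - t = (1 - b) / p by rewrite /b; field; rewrite gt_eqF.
have -> : t - s = (b - a) / p by rewrite /b /a; field; rewrite gt_eqF.
have -> : (b ^+ m.+2 - a ^+ m.+2) * ((1 - b) / p) * (m.+1%:R * B + 1) =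
  (b ^+ m.+2 - a ^+ m.+2) * (1 - b) * (m.+1%:R * B + 1) / p by ring.
have -> : m.+2%:R * B * ((b - a) / p) * (1 - b ^+ m.+2) =
  m.+2%:R * B * (b - a) * (1 - b ^+ m.+2) / p by ring.
rewrite ler_pM2r ?invr_gt0 //.
have m0 : 0 <= m.+1%:R :> R by rewrite ler0n.
have B0 := le_trans b0 bB.
rewrite -(natr1 m.+1); set k : R := m.+1%:R in m0 Ha Hb *.
rewrite -(natr1 m.+1) -/k in Ha.
have ba : 0 <= b - a by rewrite subr_ge0.
have b1 : 0 <= 1 - b by lra.
apply: (@le_trans _ _ ((b - a) * ((k + 1) * u) * (1 - b) * (k * B + 1))).
  by rewrite !ler_wpM2r // addr_ge0 // mulr_ge0.
apply: (@le_trans _ _ ((k + 1) * B * (b - a) * ((1 - b) * (k * u + 1)))); last first.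
  by rewrite ler_wpM2l // !mulr_ge0 // addr_ge0.
have -> : (b - a) * ((k + 1) * u) * (1 - b) * (k * B + 1) =
   ((b - a) * (1 - b) * (k + 1)) * (u * (k * B + 1)) by ring.
have -> : (k + 1) * B * (b - a) * ((1 - b) * (k * u + 1)) =
   ((b - a) * (1 - b) * (k + 1)) * (B * (k * u + 1)) by ring.
by rewrite ler_wpM2l ?mulr_ge0 //; nra.
Qed.

(** All orbits that start in [0, 1) merge: in probabilistic terms, a
    supercritical branching process that survives has many individuals, as
    the gap is the expectation of x^Z_n over the event Z_n > 0. *)
Lemma iter_gw_gap x (eps : R) : 0 <= x < 1 -> 0 < eps ->
  exists n, iter n G x - iter n G 0 <= eps.
Proof.
move=> /andP[x0 x1] e0.
have [d0 /andP[d00 d01] Hd] := gw_below p01 Mp.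
set d := Num.min d0 (1 - x).
have dpos : 0 < d by rewrite lt_min d00 subr_gt0.
have dd0 : d <= d0 by rewrite ge_min lexx.
have dx : d <= 1 - x by rewrite ge_min lexx orbT.
set r := 1 - d.
have Gr : G r <= r by apply/ltW/Hd; rewrite dpos.
have r0 : 0 <= r by rewrite /r; lra.
have r1 : r < 1 by rewrite /r; lra.
have xr n : iter n G x <= r.
  apply: (@le_trans _ _ (iter n G r)).
    by apply: iter_gw_mono => //; rewrite /r; lra.
  elim: n => //= n IH; apply: le_trans Gr; apply: gw_mono => //.
  exact: iter_gw_ge0.
set B := 1 - p + p * r.
have p0 : 0 < p.
  case/andP: p01 => p0 _; rewrite lt_neqAle p0 andbT eq_sym.
  by apply: contraTneq Mp => ->; rewrite mulr0 ltr10.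
have p1 : p <= 1 by case/andP: p01.
have B0 : 0 <= B by rewrite /B; nra.
have B1 : B < 1 by rewrite /B; nra.
have MM : M%:R = M.-1%:R + 1 :> R by case: M M1 => // m _; rewrite natr1.
have m0 : 0 <= M.-1%:R :> R by rewrite ler0n.
set kap := M%:R * B / (M.-1%:R * B + 1).
have den : 0 < M.-1%:R * B + 1 by rewrite ltr_wpDl // mulr_ge0.
have kap0 : 0 <= kap by rewrite divr_ge0 ?mulr_ge0 ?ler0n // ltW.
have kap1 : kap < 1 by rewrite ltr_pdivrMr // mul1r MM; nra.
(* the gap relative to 1 - iter n G x contracts by kap *)
have K n : (iter n G x - iter n G 0) <= kap ^+ n * (x / (1 - x)) * (1 - iter n G x).
  elim: n => [|n IH] /=; first by rewrite subr0 expr0 mul1r divfK ?subr_eq0 ?gt_eqF.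
  have t1 : 0 < 1 - iter n G x by rewrite subr_gt0 (le_lt_trans (xr n)).
  have := gw_contract (erefl B) (iter_gw_ge0 n (lexx 0)) (iter_gw_mono n (lexx 0) x0) (xr n) r1.
  rewrite /= -ler_pdivlMr // => H.
  have G1 : 0 <= 1 - G (iter n G x).
    by rewrite subr_ge0 (le_trans (xr n.+1)) // ltW.
  rewrite -(ler_pM2r t1); apply: (le_trans H).
  rewrite exprS.
  have -> : M%:R * B * (iter n G x - iter n G 0) * (1 - G (iter n G x)) / (M.-1%:R * B + 1) =
     (kap * (1 - G (iter n G x))) * (iter n G x - iter n G 0) by rewrite /kap; ring.
  apply: (le_trans (ler_wpM2l _ IH)); first exact: mulr_ge0.
  by rewrite le_eqVlt; apply/orP; left; apply/eqP; ring.
have C0 : 0 <= x / (1 - x) by rewrite divr_ge0 // subr_ge0 ltW.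
have [n Hn] := @exp_small kap (eps / (x / (1 - x) + 1)) (introT andP (conj kap0 kap1))
  (divr_gt0 e0 (ltr_wpDl C0 ltr01)).
exists n; apply: (le_trans (K n)).
apply: (@le_trans _ _ (kap ^+ n * (x / (1 - x) + 1))).
  rewrite -mulrA ler_wpM2l ?exprn_ge0 //.
  apply: (@le_trans _ _ (x / (1 - x) * 1)); last by rewrite mulr1 lerDl.
  by rewrite ler_wpM2l // gerBl iter_gw_ge0.
by rewrite -ler_pdivlMr ?Hn // ltr_wpDl.
Qed.

End iterate.
End galton_watson.

(** * Counting in base M, zipping, products of indicators *)

Lemma count_iota (P : pred nat) N :
  count P (iota 0 N) = (\sum_(0 <= x < N) P x)%N.
Proof. by rewrite -sum1_count big_mkcond /= /index_iota subn0; apply: eq_bigr. Qed.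

(** A sum over all children, grouped by parents. *)
Lemma sum_divmod (F : nat -> nat -> nat) (M N : nat) : (0 < M)%N ->
  (\sum_(0 <= x < N * M) F (x %/ M) (x %% M) =
   \sum_(0 <= x < N) \sum_(0 <= a < M) F x a)%N.
Proof.
move=> M0; elim: N => [|N IH]; first by rewrite !big_nil.
rewrite mulSn addnC (big_cat_nat (n := (N * M)%N)) ?leq_addr //= IH big_nat_recr //=.
congr (_ + _)%N; rewrite -{1}[(N * M)%N]add0n big_addn addKn.
apply: eq_big_nat => a /andP[_ aM].
by rewrite addnC divnMDl // modnMDl divn_small // modn_small // addn0.
Qed.

Lemma ltn_digit (a N c x : nat) : (a < N)%N -> (x < c)%N -> (a * c + x < N * c)%N.
Proof.
move=> aN xc; apply: (@leq_trans (a.+1 * c)); last by rewrite leq_mul2r aN orbT.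
by rewrite mulSn addnC ltn_add2r.
Qed.

Lemma mem_zip (S T : eqType) (s : seq S) (t : seq T) y :
  y \in zip s t -> (y.1 \in s) && (y.2 \in t).
Proof.
elim: s t => [|a s IH] [|c t] //=; rewrite inE => /orP[/eqP -> /=|/IH].
  by rewrite !inE !eqxx.
by case/andP=> ? ?; rewrite !inE; apply/andP; split; apply/orP; right.
Qed.

Lemma uniq_zip (S T : eqType) (s : seq S) (t : seq T) : uniq s -> uniq (zip s t).
Proof.
elim: s t => [|a s IH] [|c t] //= /andP[/negP as_ /IH ->]; rewrite andbT.
by apply/negP => /mem_zip /andP[/= /as_].
Qed.

Lemma zip_injl (S T : eqType) (s : seq S) (t : seq T) : uniq s ->
  {in zip s t &, forall y y', y.1 = y'.1 -> y = y'}.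
Proof.
elim: s t => [|a s IH] [|c t] //= /andP[/negP as_ us] y y'.
rewrite !inE => /orP[/eqP ->|yz] /orP[/eqP ->|yz'] //= E; last exact: (IH t).
- by move: (mem_zip yz'); rewrite -E => /andP[/as_].
- by move: (mem_zip yz); rewrite E => /andP[/as_].
Qed.

Lemma zip_injr (S T : eqType) (s : seq S) (t : seq T) : uniq t ->
  {in zip s t &, forall y y', y.2 = y'.2 -> y = y'}.
Proof.
elim: s t => [|a s IH] [|c t] //= /andP[/negP as_ us] y y'.
rewrite !inE => /orP[/eqP ->|yz] /orP[/eqP ->|yz'] //= E; last exact: (IH t).
- by move: (mem_zip yz'); rewrite -E => /andP[_ /as_].
- by move: (mem_zip yz); rewrite E => /andP[_ /as_].
Qed.

Lemma prod_all (R : realFieldType) (J : Type) (s : seq J) (P : pred J) :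
  \prod_(i <- s) (P i)%:R = (all P s)%:R :> R.
Proof.
elim: s => [|i s IH]; first by rewrite big_nil.
by rewrite big_cons IH /=; case: (P i); rewrite ?mul1r ?mul0r.
Qed.

(** * The M-ary tree and its surviving nodes *)

Local Notation node := (bool * (nat * nat))%type.

Section tree.
Context (M : nat).
Implicit Types (e : node -> bool) (b : bool) (n m k x : nat).

(** The node [(b, (n, x))] is the string of [n] base-M digits of the number
    [x < M ^ n] in the tree numbered [b].  Its parent is [(b, (n.-1, x %/ M))],
    which makes ancestors, and differences of positions, plain arithmetic. *)
Definition level n : seq node :=
  [seq (b, (n, x)) | b <- [:: false; true], x <- iota 0 (M ^ n)].

Definition levels n m : seq node := flatten [seq level k | k <- iota n.+1 m].

Lemma mem_level b k x n : ((b, (k, x)) \in level n) = (k == n) && (x < M ^ n)%N.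
Proof.
apply/allpairsP/andP => [[[b' x'] /= [_ x'N [_ -> ->]]]|[/eqP -> xN]].
  by rewrite mem_iota in x'N.
by exists (b, x); rewrite /= mem_iota; split => //; case: b.
Qed.

Lemma mem_levels b k x n m :
  ((b, (k, x)) \in levels n m) = [&& (n < k)%N, (k <= n + m)%N & (x < M ^ k)%N].
Proof.
apply/flattenP/and3P => [[s /mapP[k' + ->]]|[nk kn xk]].
  by rewrite mem_iota mem_level => /andP[? ?] /andP[/eqP -> ?]; split=> //; lia.
exists (level k); last by rewrite mem_level eqxx.
by apply: map_f; rewrite mem_iota; lia.
Qed.

Lemma levelsD n m : levels 0 (n + m) = levels 0 n ++ levels n m.
Proof. by rewrite /levels iotaD map_cat flatten_cat add1n. Qed.

Lemma levels1 n : levels n 1 = level n.+1.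
Proof. by rewrite /levels /= cats0. Qed.

(** The root carries no label. *)
Fixpoint alive e b n x : bool :=
  if n is n'.+1 then e (b, (n, x)) && alive e b n' (x %/ M) else true.

(** Embedding of a tree as the subtree hanging below the node [y b] of level
    [n], in both trees at once. *)
Definition below n (y : bool -> nat) (v : node) : node :=
  (v.1, (n + v.2.1, y v.1 * M ^ v.2.1 + v.2.2))%N.

Lemma below_inj n y : injective (below n y).
Proof. by move=> [b [k x]] [b' [k' x']] [/= <- /addnI <- /addnI <-]. Qed.

Hypothesis M0 : (0 < M)%N.

Lemma ltn_parent n x : (x < M ^ n.+1)%N -> (x %/ M < M ^ n)%N.
Proof. by rewrite expnSr ltn_divLR. Qed.

Lemma alive_below e b n y m x : (x < M ^ m)%N ->
  alive e b (n + m) (y b * M ^ m + x) =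
  alive e b n (y b) && alive (e \o below n y) b m x.
Proof.
elim: m x => [|m IH] x xM.
  by rewrite addn0 /= andbT expn0 muln1; case: x xM => //; rewrite addn0.
have E : ((y b * M ^ m.+1 + x) %/ M = y b * M ^ m + x %/ M)%N.
  by rewrite expnSr mulnA divnMDl.
by rewrite addnS /= E IH ?ltn_parent // /below /= addnS andbCA.
Qed.

Lemma supported_alive b n x : (x < M ^ n)%N ->
  supported (levels 0 n) (fun e => alive e b n x).
Proof.
elim: n x => [//|n IH] x xM e e' H /=.
rewrite H; last by rewrite mem_levels /=; lia.
congr (_ && _); apply: IH; first exact: ltn_parent.
move=> [b' [k z]] hk; apply: H; move: hk; rewrite !mem_levels; lia.
Qed.

Definition survivors e b n : seq nat := [seq x <- iota 0 (M ^ n) | alive e b n x].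

Lemma mem_survivors e b n x :
  (x \in survivors e b n) = alive e b n x && (x < M ^ n)%N.
Proof. by rewrite mem_filter mem_iota. Qed.

Lemma survivors_uniq e b n : uniq (survivors e b n).
Proof. exact/filter_uniq/iota_uniq. Qed.

Lemma supported_survivors b n :
  supported (levels 0 n) (fun e => survivors e b n).
Proof.
move=> e e' H; apply: eq_in_filter => x; rewrite mem_iota => xN.
exact: (supported_alive b xN H).
Qed.

(* configurations differing only above level n *)
Lemma agree_levels n m e e' : (forall j, j \notin levels n m -> e' j = e j) ->
  {in levels 0 n, e' =1 e}.
Proof.
move=> H [b [k x]] hk; apply: H; move: hk; rewrite !mem_levels; lia.
Qed.

Lemma sum_parents e b n :
  (\sum_(0 <= x < M ^ n.+1) alive e b n (x %/ M) =
   M * size (survivors e b n))%N.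
Proof.
rewrite size_filter count_iota expnSr.
rewrite (sum_divmod (fun x _ => alive e b n x : nat) _ M0) big_distrr /=.
by apply: eq_bigr => x _; rewrite sum_nat_const_nat subn0.
Qed.

Lemma alive_agree e e' b n x : (x < M ^ n.+1)%N ->
  (forall j, j \notin level n.+1 -> e' j = e j) ->
  alive e' b n (x %/ M) = alive e b n (x %/ M).
Proof.
move=> xM He; apply: (supported_alive b (ltn_parent xM)).
by move: He; rewrite -levels1; apply: agree_levels.
Qed.

Definition sel (y : nat * nat) (b : bool) := if b then y.2 else y.1.

(** Pairing survivors of the two trees without repetition: distinct pairs share
    neither coordinate, so the pairs of subtrees below them are independent. *)
Definition matched e n := zip (survivors e false n) (survivors e true n).

Lemma supported_below (V : Type) (F : (node -> bool) -> V) n m y :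
  (forall b, y b < M ^ n)%N -> supported (levels 0 m) F ->
  supported (levels n m) (fun e => F (e \o below n y)).
Proof.
move=> yn HF e e' H; apply: HF => -[b [k x]] hk /=; apply: H.
move: hk; rewrite !mem_levels => /and3P[k0 km xk] /=.
apply/and3P; split; [lia|lia|].
rewrite expnD; exact: ltn_digit.
Qed.

Section matching.
Context (Phi : nat -> (node -> bool) -> bool).

Definition fails n m e : bool :=
  [&& survivors e false n != [::], survivors e true n != [::] &
    all (fun y => ~~ Phi m (e \o below n (sel y))) (matched e n)].

Lemma supported_fails n m : (forall m, supported (levels 0 m) (Phi m)) ->
  supported (levels 0 (n + m)) (fails n m).
Proof.
move=> Phi_supported e e' H.
have Hn : {in levels 0 n, e =1 e'}.
  by move=> j jn; apply: H; rewrite levelsD mem_cat jn.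
have E b := supported_survivors b Hn.
rewrite /fails /matched !E; congr [&& _, _ & _]; apply: eq_in_all => y yz; congr (~~ _).
have Hy b : (sel y b < M ^ n)%N.
  by move: (mem_zip yz); rewrite !mem_survivors => /andP[/andP[_ ?] /andP[_ ?]]; case: b.
apply: (supported_below Hy (@Phi_supported m)) => j jn; apply: H.
by rewrite levelsD mem_cat jn orbT.
Qed.

End matching.

Section moments.
Context {R : realType} (p : R).

(** Given level [n], the labels of the [M * Z_n] candidate children are fresh. *)
Lemma expect_offspring s b n e :
  expect p (level n.+1) (fun e' => s ^+ size (survivors e' b n.+1)) e =
  gw M p s ^+ size (survivors e b n).
Proof.
set cs := [seq x <- iota 0 (M ^ n.+1) | alive e b n (x %/ M)].
have szcs : size cs = (M * size (survivors e b n))%N.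
  by rewrite -sum_parents size_filter count_iota.
pose Phi x e' : R := if e' (b, (n.+1, x)) then s else 1.
transitivity (expect p (level n.+1) (fun e' => \prod_(x <- cs) Phi x e') e).
  apply: eq_expect => e' He'.
  have -> : survivors e' b n.+1 = [seq x <- cs | e' (b, (n.+1, x))].
    rewrite -filter_predI; apply: eq_in_filter => x; rewrite mem_iota /= => xN.
    by rewrite (alive_agree b xN He').
  rewrite size_filter -big_mkcond; elim: (cs) => [|x r IH]; first by rewrite big_nil.
  by rewrite big_cons /= -IH; case: (e' _); rewrite ?exprS.
rewrite (expect_blocks p (blk := fun x => [:: (b, (n.+1, x))])).
- under eq_bigr => x _ do rewrite /= /Phi /upd eqxx.
  rewrite big_const_seq count_predT szcs /gw -exprM iter_mulr_1.
  by congr (_ ^+ _); ring.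
- exact/filter_uniq/iota_uniq.
- by move=> x _ e1 e2 H; rewrite /Phi H // mem_head.
- by move=> x y _ _ j; rewrite !inE => /eqP -> /eqP [].
- move=> x; rewrite mem_filter mem_iota => /and3P[_ _ xN] j.
  by rewrite inE => /eqP ->; rewrite mem_level eqxx.
Qed.

Lemma expect_generating s b n e :
  expect p (levels 0 n) (fun e' => s ^+ size (survivors e' b n)) e =
  iter n (gw M p) s.
Proof.
elim: n s => [|n IH] s /=; first by rewrite expr1.
rewrite -addn1 levelsD expect_cat addn1 -iterS iterSr -IH.
by apply: eq_expect => e' _; rewrite levels1 expect_offspring.
Qed.

Section zero_one.
Context (Phi : nat -> (node -> bool) -> bool) (eps : R).
Hypothesis p01 : 0 <= p <= 1.
Hypothesis Phi_supported : forall m, supported (levels 0 m) (Phi m).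
Hypothesis Phi_expect : forall m e,
  eps <= expect p (levels 0 m) (fun e' => (Phi m e')%:R) e.

Lemma zero_one_eps_le1 : eps <= 1.
Proof.
apply: (le_trans (Phi_expect 0 (fun=> true))) => /=; by rewrite lern1 leq_b1.
Qed.

(** Given level [n], the matched pairs fail independently, each with
    probability at most x = 1 - eps, so the conditional probability is at
    most x^min(Z_1, Z_2), which is at most x^Z_1 + x^Z_2.  Subtracting [0 ^+ Z]
    encodes that the event requires [Z] to be nonzero. *)
Lemma expect_fails_cond n m e : 0 <= eps ->
  expect p (levels n m) (fun e' => (fails Phi n m e')%:R) e <=
  ((1 - eps) ^+ size (survivors e false n) - 0 ^+ size (survivors e false n)) +
  ((1 - eps) ^+ size (survivors e true n) - 0 ^+ size (survivors e true n)).
Proof.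
move=> eps0; set x := 1 - eps.
have x0 : 0 <= x by rewrite subr_ge0 zero_one_eps_le1.
have x1 : x <= 1 by rewrite /x gerBl.
have D k : 0 <= x ^+ k - 0 ^+ k.
  by case: k => [|k]; rewrite ?expr0 ?subrr // expr0n subr0 exprn_ge0.
have E e' b : (forall j, j \notin levels n m -> e' j = e j) ->
    survivors e' b n = survivors e b n.
  by move=> H; apply: (supported_survivors b (agree_levels H)).
case: (boolP ((survivors e false n != [::]) && (survivors e true n != [::]))); last first.
  move=> H; rewrite (eq_expect p (Psi := fun=> 0)) ?expect_cst; first by rewrite addr_ge0 ?D.
  by move=> e' He'; rewrite /fails !(E e') // andbA (negPf H).
move=> H; have /andP[H1 H2] := H.
rewrite !expr0n !size_eq0 (negPf H1) (negPf H2) !subr0.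
pose F y e' : R := (~~ Phi m (e' \o below n (sel y)))%:R.
rewrite (eq_expect p (Psi := fun e' => \prod_(y <- matched e n) F y e')); last first.
  move=> e' He'; rewrite /fails /matched !(E e') // andbA H /= -prod_all.
  exact: eq_bigr.
have Hy y b : y \in matched e n -> (sel y b < M ^ n)%N.
  by move=> /mem_zip; rewrite !mem_survivors => /andP[/andP[_ ?] /andP[_ ?]]; case: b.
rewrite (expect_blocks p (blk := fun y => map (below n (sel y)) (levels 0 m))).
- apply: (@le_trans _ _ (\prod_(y <- matched e n) x)).
    apply: ler_prod => y _.
    have -> : expect p (map (below n (sel y)) (levels 0 m)) (F y) e =
       1 - expect p (levels 0 m) (fun e' => (Phi m e')%:R) (e \o below n (sel y)).
      rewrite -[RHS]opprB -[LHS]opprK; congr (- _).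
      rewrite -[X in _ = _ - X](expect_cst p (levels 0 m) 1 (e \o below n (sel y))).
      rewrite -mulN1r -expectZ -[X in _ = _ - X]mul1r -[_ - _]/(_ + _).
      rewrite -mulNr -expectZ -expectD (expect_map p _ (fun e' => -1 * (~~ Phi m e')%:R)).
        by apply: eq_expect => e' _; case: (Phi m e') => /=; ring.
      exact: below_inj.
    rewrite lerD2l lerN2 Phi_expect andbT subr_ge0.
    rewrite -[leRHS](expect_cst p (levels 0 m) 1 (e \o below n (sel y))).
    by apply: ler_expect => // e' _; rewrite lern1 leq_b1.
  rewrite big_const_seq count_predT iter_mulr_1 size_zip /minn.
  by case: ifP => _; rewrite ?lerDl ?lerDr exprn_ge0.
- by apply: uniq_zip; apply: survivors_uniq.
- move=> y yz e1 e2 H'; rewrite /F; congr ((~~ _)%:R).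
  by apply: Phi_supported => j jm /=; apply: H'; apply: map_f.
- move=> y y' yz yz' j /mapP[[b [k z]] hk ->] /mapP[[b' [k' z']] hk' [<-]].
  move=> /addnI kk'; rewrite -kk' in hk' * => Ez.
  move: hk hk'; rewrite !mem_levels => /and3P[_ _ zk] /and3P[_ _ zk'].
  have {Ez} Es : sel y b = sel y' b.
    have := congr1 (fun t => t %/ M ^ k)%N Ez.
    by rewrite /= !divnMDl ?expn_gt0 ?M0 // !divn_small // !addn0.
  case: b Es => /= Es; first exact: zip_injr (survivors_uniq e true n) _ _ yz yz' Es.
  exact: zip_injl (survivors_uniq e false n) _ _ yz yz' Es.
- move=> y yz j /mapP[[b [k z]] hk ->].
  move: hk; rewrite !mem_levels => /and3P[k0 km zk] /=.
  apply/and3P; split; [lia|lia|].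
  by rewrite expnD ltn_digit // Hy.
Qed.

(** The bound does not depend on [m], so it survives the limit in [m]. *)
Lemma expect_fails n m e : 0 <= eps ->
  expect p (levels 0 (n + m)) (fun e' => (fails Phi n m e')%:R) e <=
  2 * (iter n (gw M p) (1 - eps) - iter n (gw M p) 0).
Proof.
move=> eps0; rewrite levelsD expect_cat.
pose D b e' : R := (1 - eps) ^+ size (survivors e' b n) +
   - 1 * 0 ^+ size (survivors e' b n).
have ED b : expect p (levels 0 n) (D b) e =
    iter n (gw M p) (1 - eps) - iter n (gw M p) 0.
  by rewrite expectD expectZ !expect_generating mulN1r.
rewrite mulr_natl mulr2n -{1}(ED false) -(ED true) -expectD.
by apply: ler_expect => // e' _; rewrite /D !mulN1r expect_fails_cond.
Qed.

End zero_one.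
End moments.
End tree.

(** * Probabilities of events that see finitely many labels *)

Section bernoulli_family.
Context {d : measure_display} {T : measurableType d} {R : realType}
  (P : probability T R) {I : eqType} (p : R) (D : pred I) (Y : T -> I -> bool).

Definition label_weight (c : bool) : R := if c then p else 1 - p.

Definition atom (s : seq I) (a : I -> bool) : set T :=
  [set w | all (fun j => Y w j == a j) s].

Lemma atom_cons i s a : atom (i :: s) a = [set w | Y w i = a i] `&` atom s a.
Proof. by apply/seteqP; split=> [w /andP[/eqP]|w [] /= /eqP h1 h2]; rewrite /atom //= h1. Qed.

Lemma eq_atom s a a' : {in s, a =1 a'} -> atom s a = atom s a'.
Proof.
by move=> H; apply/seteqP; split=> w; rewrite /atom /= => /allP K;
  apply/allP => j js; [rewrite -H|rewrite H] => //; apply: K.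
Qed.

(** The joint law of the labels, given by the atoms of finite subfamilies; no
    sigma-algebra is left to deal with. *)
Definition bernoulli_family :=
  forall s a, uniq s -> all D s ->
    measurable (atom s a) /\ P (atom s a) = (\prod_(j <- s) label_weight (a j))%:E.

Hypothesis hY : bernoulli_family.

Lemma expect_upd (s : seq I) (Phi : (I -> bool) -> R) i c e : i \notin s ->
  supported (i :: s) Phi ->
  expect p s Phi (upd e i c) = expect p s (fun e' => Phi (upd e' i c)) e.
Proof.
move=> is_ H.
have Hs : supported s (fun e' => Phi (upd e' i c)).
  move=> e1 e2 H12; apply: H => j; rewrite inE /upd.
  by case: eqVneq => //= _; apply: H12.
rewrite (expect_supported p (s := s) (e' := upd e i c) Hs); last by move=> j ->.
apply: eq_expect => e' He'; congr (Phi _); apply/funext => j; rewrite /upd.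
by case: eqVneq => // ->; rewrite He' // /upd eqxx.
Qed.

(** Revealing the labels of [s] one at a time; the labels of [s0] are those
    already revealed. *)
Lemma cylinder_event (s s0 : seq I) (Phi : (I -> bool) -> bool) a e :
  uniq (s ++ s0) -> all D (s ++ s0) -> supported s Phi ->
  let E := atom s0 a `&` [set w | Phi (Y w)] in
  measurable E /\ P E =
    (\prod_(j <- s0) label_weight (a j) * expect p s (fun e' => (Phi e')%:R) e)%:E.
Proof.
elim: s s0 Phi a e => [|i s IH] s0 Phi a e /=.
  move=> us Ds H; have [mA PA] := hY a us Ds.
  have E : [set w | Phi (Y w)] = if Phi e then setT else set0.
    apply/seteqP; split => w /=; rewrite (H (Y w) e) //; by case: (Phi e).
  rewrite E; case: (Phi e); first by rewrite setIT mulr1.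
  by rewrite setI0 mulr0 measure0.
move=> /andP[iss us] /andP[Di Ds] H.
have [is_ is0] : i \notin s /\ i \notin s0.
  by move: iss; rewrite mem_cat negb_or => /andP.
have Hc c : supported s (fun e' => Phi (upd e' i c)).
  move=> e1 e2 H12; apply: H => j; rewrite inE /upd.
  by case: eqVneq => //= _; apply: H12.
have us' : uniq (s ++ i :: s0).
  by rewrite -cat1s uniq_catCA /= iss us.
have Ds' : all D (s ++ i :: s0) by move: Ds; rewrite !all_cat /= Di.
pose E c := atom (i :: s0) (upd a i c) `&` [set w | Phi (upd (Y w) i c)].
have EE : atom s0 a `&` [set w | Phi (Y w)] = E true `|` E false.
  have K c w : Y w i = c -> (atom s0 a `&` [set w | Phi (Y w)]) w <-> E c w.
    move=> Yc; rewrite /E atom_cons (eq_atom (a' := a)).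
      have Eu : upd (Y w) i c = Y w.
        by apply/funext => j; rewrite /upd; case: eqVneq => [->|//].
      by rewrite upd_same; split => [[h1 h2]|[[_ h1] h2]];
        split => //=; move: h2; rewrite /= Eu.
    by move=> j js; rewrite upd_other //; apply: contraNneq is0 => <-.
  apply/seteqP; split => w.
    by case Yw: (Y w i) => h; [left|right]; apply/(K _ _ Yw).
  by case=> h; apply/(K _ w); try exact: h; move: h; rewrite /E atom_cons upd_same => -[[]].
have PE c : measurable (E c) /\ P (E c) = (\prod_(j <- i :: s0)
    label_weight (upd a i c j) * expect p s (fun e' => (Phi (upd e' i c))%:R) e)%:E.
  exact: IH.
rewrite EE; split; first by apply: measurableU; apply PE.
rewrite measureU; [|exact: (PE true).1|exact: (PE false).1|]; last first.
  apply/seteqP; split => // w [[h1 _] [h2 _]]; move: h1 h2.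
  by rewrite !atom_cons !upd_same /= => -[-> _] [].
apply: (etrans (congr2 (fun x y => x + y)%E (PE true).2 (PE false).2)).
rewrite /= -EFinD; congr (_%:E).
have Hp c : \prod_(j <- i :: s0) label_weight (upd a i c j) =
    label_weight c * \prod_(j <- s0) label_weight (a j).
  rewrite big_cons upd_same; congr (_ * _).
  apply: eq_big_seq => j js; rewrite /upd; case: eqVneq => // ji.
  by rewrite -ji js in is0.
have HR : supported (i :: s) (fun e' => (Phi e')%:R : R).
  by move=> e1 e2 H12; rewrite (H e1 e2).
by rewrite !Hp !(expect_upd _ _ is_ HR) /label_weight; ring.
Qed.

Lemma event_prob (s : seq I) (Phi : (I -> bool) -> bool) e :
  uniq s -> all D s -> supported s Phi ->
  measurable [set w | Phi (Y w)] /\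
  P [set w | Phi (Y w)] = (expect p s (fun e' => (Phi e')%:R) e)%:E.
Proof.
move=> us Ds H.
have [] := @cylinder_event s [::] Phi e e _ _ H; rewrite ?cats0 //.
have -> : atom [::] e = setT by apply/seteqP; split.
by rewrite setTI big_nil mul1r.
Qed.

End bernoulli_family.

(** * Strings as base M numerals *)

Section digits.
Context (M : nat) (M0 : (0 < M)%N).

Fixpoint digits (n x : nat) : seq 'I_M :=
  if n is n'.+1 then rcons (digits n' (x %/ M)%N) (Ordinal (ltn_pmod x M0))
  else [::].

Definition numeral (u : seq 'I_M) : nat := foldl (fun y (a : 'I_M) => y * M + a)%N 0%N u.

Lemma size_digits n x : size (digits n x) = n.
Proof. by elim: n x => //= n IH x; rewrite size_rcons IH. Qed.

Lemma digitsK n x : (x < M ^ n)%N -> numeral (digits n x) = x.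
Proof.
elim: n x => [|n IH] x xM; first by case: x xM.
rewrite /numeral /= foldl_rcons -/(numeral _) IH ?ltn_parent //=.
by rewrite -divn_eq.
Qed.

Lemma numeral_rcons u a : numeral (rcons u a) = (numeral u * M + a)%N.
Proof. by rewrite /numeral foldl_rcons. Qed.

Lemma numeralK u : digits (size u) (numeral u) = u.
Proof.
elim/last_ind: u => // u a IH; rewrite size_rcons /= numeral_rcons.
rewrite divnMDl // divn_small // addn0 IH; congr rcons; apply/val_inj => /=.
by rewrite modnMDl modn_small.
Qed.

Lemma numeral_lt u : (numeral u < M ^ size u)%N.
Proof.
elim/last_ind: u => // u a IH; rewrite size_rcons numeral_rcons expnSr.
exact: ltn_digit.
Qed.

Lemma take_digits n x k : (k <= n)%N ->
  take k (digits n x) = digits k (x %/ M ^ (n - k))%N.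
Proof.
elim: n x => [|n IH] x; first by case: k.
rewrite leq_eqVlt => /orP[/eqP ->|kn].
  by rewrite subnn expn0 divn1 take_oversize // size_digits.
rewrite /= -cats1 takel_cat ?size_digits // IH // -divnMA subSn //.
by rewrite expnS.
Qed.
End digits.

(** * The labels of both percolations form one Bernoulli family *)

Section labels.
Context {d : measure_display} {T : measurableType d} {R : realType}
  (P : probability T R) (M : nat) (p : R) (M0 : (0 < M)%N)
  (X1 X2 : seq 'I_M -> {RV P >-> bool}).
Hypotheses (p01 : 0 <= p <= 1) (hX1 : percolation_labels p X1)
  (hX2 : percolation_labels p X2) (hX12 : independent_families strings X1 X2).

Definition node_label (w : T) (v : node) : bool :=
  (if v.1 then X2 else X1) (digits M0 v.2.1 v.2.2) w.

(** Labels of the root, and of positions that no string has, are excluded: the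
    percolations put no condition on them. *)
Definition proper_node (v : node) := (0 < v.2.1)%N && (v.2.2 < M ^ v.2.1)%N.

Lemma label_prob (X : seq 'I_M -> {RV P >-> bool}) u c :
  percolation_labels p X -> u != [::] ->
  P (X u @^-1` [set c]) = (label_weight p c)%:E.
Proof.
move=> [H _] u0; rewrite -[LHS]/(distribution P (X u) [set c]) H //.
rewrite bernoulli_probE // !diracE /label_weight /unstable.onem.
by case: c; rewrite (mem_set (erefl : [set _] _)) memNset // ?mule1 ?mule0 ?adde0 ?add0e.
Qed.

Lemma prob_cylinder (X : seq 'I_M -> {RV P >-> bool}) (s : seq (seq 'I_M)) a :
  percolation_labels p X -> uniq s -> {in s, forall u, u != [::]} ->
  P (\bigcap_(u in [set` s]) X u @^-1` [set a u]) =
  (\prod_(u <- s) label_weight p (a u))%:E.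
Proof.
move=> hX us s0; have [_ H] := hX.
rewrite (H s (fun u => [set a u])) //.
rewrite -prodEFin; apply: eq_big_seq => u us'; apply: label_prob => //; exact: s0.
Qed.

(** Needed because the independence of the two percolations is stated for the
    generated sigma-algebras. *)
Lemma generated_cylinder (X : seq 'I_M -> {RV P >-> bool}) (s : seq (seq 'I_M)) a :
  {in s, forall u, u != [::]} ->
  generated_sigma_algebra strings X (\bigcap_(u in [set` s]) X u @^-1` [set a u]).
Proof.
move=> s0; rewrite /generated_sigma_algebra.
set G := \bigcup_(i in _) _.
rewrite bigcap_seq.
suff : measurable (\big[setI/setT]_(i <- s) (X i @^-1` [set a i]) : set (g_sigma_algebraType G)) by [].
rewrite big_seq; apply: (@bigsetI_measurable _ (g_sigma_algebraType G)) => u us.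
apply: sub_sigma_algebra; exists u; first exact: s0.
by exists [set a u] => //; rewrite setTI.
Qed.

(** A finite set of nodes splits into its two trees; each part is handled by
    the mutual independence within a percolation, and the parts are combined
    by the independence of the two percolations. *)
Lemma node_label_bernoulli : bernoulli_family P p proper_node node_label.
Proof.
move=> s a us Ds.
pose str (v : node) := digits M0 v.2.1 v.2.2.
pose part b := [seq v <- s | v.1 == b].
pose al b u := a (b, (size u, numeral (M := M) u)).
have str0 b : {in map str (part b), forall u, u != [::]}.
  move=> u /mapP[v]; rewrite mem_filter => /andP[_ vs ->].
  have /andP[v0 _] := allP Ds v vs.
  by rewrite -size_eq0 size_digits -lt0n.
have alK b v : v \in part b -> al b (str v) = a v.
  rewrite mem_filter => /andP[/eqP vb vs]; have /andP[_ vM] := allP Ds v vs.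
  by rewrite /al size_digits digitsK // -vb; case: v {vb vs vM} => [? [? ?]].
have ustr b : uniq (map str (part b)).
  rewrite map_inj_in_uniq ?filter_uniq // => v v'.
  rewrite !mem_filter => /andP[/eqP vb vs] /andP[/eqP vb' vs'] E.
  have /andP[_ vM] := allP Ds v vs; have /andP[_ vM'] := allP Ds v' vs'.
  have E1 : v.2.1 = v'.2.1 by rewrite -(size_digits M0 v.2.1 v.2.2) -/(str v) E size_digits.
  have E2 : v.2.2 = v'.2.2.
    by rewrite -(digitsK M0 vM) -/(str v) E (digitsK M0 vM').
  by case: v v' vb vb' E1 E2 {vs vs' E vM vM'} => [? [? ?]] [? [? ?]] /= -> -> -> ->.
pose X b := if b then X2 else X1.
pose C b := \bigcap_(u in [set` map str (part b)]) X b u @^-1` [set al b u].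
have CE b w : C b w <-> all (fun j => node_label w j == a j) (part b).
  split => [H|/allP H].
    apply/allP => v vp; have := H (str v) (map_f _ vp) => /= E.
    rewrite -(alK b v vp) -E /node_label /X.
    by move: vp; rewrite mem_filter => /andP[/eqP -> _].
  move=> u /= /mapP[v vp ->]; rewrite alK //; apply/eqP; rewrite -(eqP (H v vp)).
  by rewrite /node_label /X /=; move: vp; rewrite mem_filter => /andP[/eqP -> _].
have AE : atom node_label s a = C false `&` C true.
  apply/seteqP; split => [w /allP H|w [/CE/allP H1 /CE/allP H2]].
    by split; apply/CE/allP => v; rewrite mem_filter => /andP[_ /H].
  apply/allP => v vs; case vb: v.1; first by apply: H2; rewrite mem_filter vb.
  by apply: H1; rewrite mem_filter vb.
have mC b : measurable (C b).
  rewrite /C bigcap_seq; apply: bigsetI_measurable => u _.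
  by rewrite -[X in measurable X]setTI; apply: measurable_funP.
split; first by rewrite AE; apply: measurableI.
rewrite AE hX12; [|exact: (generated_cylinder _ (@str0 false))|
  exact: (generated_cylinder _ (@str0 true))].
have PC b : P (C b) = (\prod_(v <- part b) label_weight p (a v))%:E.
  rewrite /C prob_cylinder //; last by rewrite /X; case: b.
  by rewrite big_map; congr (_%:E); apply: eq_big_seq => v vp; rewrite alK.
rewrite -/(C false) -/(C true) !PC -EFinM; congr (_%:E).
rewrite !big_filter [RHS](bigID (fun v => v.1 == false)) /=; congr (_ * _).
by apply: eq_bigl => v; case: v.1.
Qed.

End labels.

(** * From finite levels to almost sure statements *)

Section null_sets.
Context {d : measure_display} {T : measurableType d} {R : realType}
  (P : probability T R).

(** The exceptional sets below are not shown to be measurable; they are only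
    enclosed in measurable events of small probability. *)
Lemma negligible_small (A : set T) :
  (forall eps : R, 0 < eps -> exists B, [/\ measurable B, A `<=` B & (P B <= eps%:E)%E]) ->
  P.-negligible A.
Proof.
move=> H.
have /choice[B HB] : forall k : nat, exists B : set T,
    [/\ measurable B, A `<=` B & (P B <= (k.+1%:R^-1)%:E)%E].
  by move=> k; apply: H; rewrite invr_gt0.
have mB : measurable (\bigcap_k B k).
  by apply: bigcap_measurable => // k _; have [] := HB k.
exists (\bigcap_k B k); split => //; last first.
  by move=> w Aw k _; have [_ + _] := HB k; apply.
apply/eqP; rewrite eq_le measure_ge0 andbT; apply/lee_addgt0Pr => e e0.
have [k Hk] := le_inv_nat e0.
rewrite add0e; have [mBk _ PBk] := HB k.
apply: (@le_trans _ _ (P (B k))).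
  by apply: le_measure; rewrite ?inE //; apply: bigcap_inf.
by apply: (le_trans PBk); rewrite lee_fin.
Qed.

Lemma measure_bigcup_le (F : nat -> set T) (c : R) :
  (forall m, measurable (F m)) -> (forall m, F m `<=` F m.+1) ->
  (forall m, (P (F m) <= c%:E)%E) -> (P (\bigcup_m F m) <= c%:E)%E.
Proof.
move=> mF incF PF.
have mono : {homo F : n m / (n <= m)%N >-> (n <= m)%O}.
  apply: homo_leq => [?|? ? ?|m]; [exact: lexx|exact: le_trans|].
  by rewrite subsetEset.
have C := nondecreasing_cvg_mu (mu := P) mF (bigcup_measurable (fun m _ => mF m)) mono.
rewrite -(cvg_lim _ C) //; apply: lime_le; first by apply/cvg_ex; eexists; exact: C.
by apply: nearW => m; apply: PF.
Qed.
End null_sets.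

Section almost_sure.
Context {d : measure_display} {T : measurableType d} {R : realType}
  (P : probability T R) (M : nat) (p : R) (Y : T -> node -> bool).
Hypotheses (p01 : 0 <= p <= 1) (hY : bernoulli_family P p (proper_node M) Y).

Lemma level_event n (Phi : (node -> bool) -> bool) e :
  supported (levels M 0 n) Phi ->
  measurable [set w | Phi (Y w)] /\
  P [set w | Phi (Y w)] = (expect p (levels M 0 n) (fun e' => (Phi e')%:R) e)%:E.
Proof.
move=> H.
have Hu : supported (undup (levels M 0 n)) Phi.
  by apply: supported_sub H => j; rewrite mem_undup.
have [|mE PE] := event_prob hY e (undup_uniq _) _ Hu.
  apply/allP => -[b [k x]]; rewrite mem_undup mem_levels /proper_node /=.
  by case/and3P=> -> _ ->.
split => //; rewrite PE; congr (_%:E).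
rewrite [RHS](@expect_sub _ _ _ (undup (levels M 0 n)) _ _ _ e) //.
  by move=> e1 e2 H12; rewrite (Hu e1 e2).
by move=> j; rewrite mem_undup.
Qed.

(** If the expectations of [W n] tend to 0 then almost surely [W n] takes small
    values at arbitrarily deep levels: staying above a fixed bound from some
    level on has, by Markov's inequality at a single deep level, probability
    as small as desired. *)
Lemma markov_ae (W : nat -> (node -> bool) -> R) (a : nat -> R) e :
  (forall n, supported (levels M 0 n) (W n)) -> (forall n e, 0 <= W n e) ->
  (forall n, expect p (levels M 0 n) (W n) e <= a n) ->
  (forall delta, 0 < delta -> exists N, forall n, (N <= n)%N -> a n <= delta) ->
  {ae P, forall w, forall k N : nat,
    exists2 n, (N <= n)%N & W n (Y w) < k.+1%:R^-1}.
Proof.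
move=> Ws W0 EW a0; apply: ae_foralln => k; apply: ae_foralln => N.
apply: negligible_small => eps eps0.
have k0 : 0 < k.+1%:R :> R by rewrite ltr0Sn.
have [N' HN'] := a0 (eps / k.+1%:R) (divr_gt0 eps0 k0).
set n := maxn N N'.
pose E e := k.+1%:R^-1 <= W n e.
have sE : supported (levels M 0 n) E by move=> e1 e2 H; rewrite /E (Ws n e1 e2).
have [mE PE] := level_event e sE.
exists [set w | E (Y w)]; split => //.
  move=> w /= H; rewrite /E leNgt; apply/negP => Hn; apply: H.
  by exists n => //; rewrite leq_maxl.
rewrite PE lee_fin; apply: (@le_trans _ _ (expect p (levels M 0 n) (fun e' => k.+1%:R * W n e') e)).
  apply: ler_expect => // e' _; rewrite /E; case: (leP _ (W n e')) => h /=; last by rewrite mulr0n mulr_ge0.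
  by rewrite mulr1n -ler_pdivrMl // mulr1.
rewrite expectZ -ler_pdivlMl // mulrC; apply: (le_trans (EW n)); apply: HN'.
exact: leq_maxr.
Qed.

(** An event of positive probability occurs below some pair of survivors
    almost surely when both trees survive: otherwise, at every level, it
    fails below all matched pairs, and by [expect_fails] and [iter_gw_gap]
    this is unlikely at deep levels because survivors abound there.  The
    event is the decreasing limit of the finitely supported [Phi m]. *)
Lemma zero_one_ae (Phi : nat -> (node -> bool) -> bool) (eps : R) :
  (2 <= M)%N -> 1 < M%:R * p -> 0 < eps ->
  (forall m, supported (levels M 0 m) (Phi m)) ->
  (forall m e, Phi m.+1 e -> Phi m e) ->
  (forall m e, eps <= expect p (levels M 0 m) (fun e' => (Phi m e')%:R) e) ->
  {ae P, forall w, (forall b n, survivors M (Y w) b n != [::]) ->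
    exists n y, (forall b, sel y b \in survivors M (Y w) b n) /\
      forall m, Phi m (Y w \o below M n (sel y))}.
Proof.
move=> M1 Mp eps0 Phis Phid Phie; have M0 : (0 < M)%N by apply: ltnW.
have Phile m m' e : (m <= m')%N -> Phi m' e -> Phi m e.
  by move=> /subnK <-; elim: (m' - m)%N => //= k IH /Phid /IH.
have epsle1 : eps <= 1 by apply: (zero_one_eps_le1 (M := M) (Phi := Phi)); exact: Phie.
apply: negligible_small => delta delta0.
have [||n Hn] := @iter_gw_gap R M p M1 p01 Mp (1 - eps) (delta / 2).
- by rewrite subr_ge0 epsle1 gtrBl.
- by rewrite divr_gt0.
pose F m := [set w | fails M Phi n m (Y w)].
have HF m := level_event (fun=> true) (@supported_fails M M0 Phi n m Phis).
exists (\bigcup_m F m); split.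
- by apply: bigcup_measurable => m _; exact: (HF m).1.
- move=> w /= H.
  have [surv Hw] : (forall b n, survivors M (Y w) b n != [::]) /\
     ~ (exists n y, (forall b, sel y b \in survivors M (Y w) b n) /\
        forall m, Phi m (Y w \o below M n (sel y))).
    by apply/not_implyP.
  have Hy y : y \in matched M (Y w) n -> exists m, ~~ Phi m (Y w \o below M n (sel y)).
    move=> yz; apply: contrapT => Hm; apply: Hw; exists n, y; split.
      by move: (mem_zip yz) => /andP[? ?]; case.
    by move=> m; apply: contrapT => /negP Hm'; apply: Hm; exists m.
  (* Phi m decreases with m, so a single m serves the finitely many pairs *)
  have [m Hm] : exists m, all (fun y => ~~ Phi m (Y w \o below M n (sel y))) (matched M (Y w) n).
    elim: (matched M (Y w) n) Hy => [|y s IH] Hy; first by exists 0%N.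
    have [m1 H1] := Hy y (mem_head _ _).
    have [|m2 H2] := IH; first by move=> z zs; apply: Hy; rewrite inE zs orbT.
    exists (maxn m1 m2) => /=; apply/andP; split.
      by apply: contra H1; apply: Phile; rewrite leq_maxl.
    apply/allP => z /(allP H2); apply: contra; apply: Phile; exact: leq_maxr.
  by exists m => //; rewrite /F /= /fails !surv.
- apply: measure_bigcup_le => [m|m|m]; first exact: (HF m).1.
    move=> w; rewrite /F /= /fails => /and3P[-> -> /allP H] /=; apply/allP => y /H.
    exact/contra/Phid.
  rewrite (HF m).2 lee_fin; apply: (le_trans (@expect_fails M M0 R p Phi eps p01 Phis Phie n m _ (ltW eps0))).
  by rewrite -ler_pdivlMl // mulrC.
Qed.

End almost_sure.

(** * Infinite branches *)

Section konig.
Context (A : eqType) (L : nat -> seq A) (par : A -> A) (Q : nat -> A -> Prop).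
Hypotheses (Qfin : forall n y, Q n y -> y \in L n)
  (Qpar : forall n y, Q n.+1 y -> Q n (par y)) (Qex : forall n, exists y, Q n y).

(** [y] has descendants in [Q] at every later level. *)
Definition deep n y := forall m, exists2 z, Q (n + m) z & iter m par z = y.

Lemma iter_par n m z : Q (n + m) z -> Q n (iter m par z).
Proof.
elim: m z => [|m IH] z; first by rewrite addn0.
by rewrite addnS iterSr => /Qpar; apply: IH.
Qed.

(** If no element of the finite list [S] were deep, a common level would exist
    beyond which none of them has a descendant. *)
Lemma deep_pigeonhole n (S : seq A) :
  (forall m, exists2 z, Q (n + m) z & iter m par z \in S) ->
  exists2 y, y \in S & deep n y.
Proof.
move=> H; apply: contrapT => Hn.
have {Hn} Hd y : y \in S -> exists m, forall z, Q (n + m) z -> iter m par z <> y.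
  move=> yS; apply: contrapT => Hm; apply: Hn; exists y => // m.
  apply: contrapT => Hz; apply: Hm; exists m => z Qz E; apply: Hz; by exists z.
have [m Hm] : exists m, forall y z, y \in S -> Q (n + m) z -> iter m par z <> y.
  elim: S {H} Hd => [|y S IH] Hd; first by exists 0%N.
  have [m1 H1] := Hd y (mem_head _ _).
  have [|m2 H2] := IH; first by move=> z zS; apply: Hd; rewrite inE zS orbT.
  have step m m' y' z : Q (n + (m' + m)) z ->
      iter (m' + m) par z = y' -> exists2 z', Q (n + m) z' & iter m par z' = y'.
    rewrite addnCA addnC => Qz E; exists (iter m' par z); last by rewrite -iterD addnC.
    exact: iter_par Qz.
  exists (m2 + m1)%N => y' z; rewrite inE => /orP[/eqP ->|y'S] Qz E.
    by have [z' Qz' Ez'] := step _ _ _ _ Qz E; apply: H1 Ez'.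
  rewrite (addnC m2) in Qz E.
  by have [z' Qz' Ez'] := step _ _ _ _ Qz E; apply: H2 y'S Qz' Ez'.
by have [z Qz zS] := H m; apply: (Hm _ z zS Qz).
Qed.

(** An infinite tree with finite levels has an infinite branch; it replaces
    compactness arguments below. *)
Lemma konig : exists g : nat -> A, forall n, Q n (g n) /\ par (g n.+1) = g n.
Proof.
have [y0 _ deep0] : exists2 y, y \in L 0 & deep 0 y.
  apply: deep_pigeonhole => m; have [z Qz] := Qex m; exists z => //.
  by apply: Qfin; apply: iter_par; rewrite add0n.
have /choice[f Hf] : forall ny : nat * A, exists y',
    deep ny.1 ny.2 -> par y' = ny.2 /\ deep ny.1.+1 y'.
  move=> [n y]; have [D|nD] := pselect (deep n y); last by exists y.
  have [|y' y'S Dy'] := @deep_pigeonhole n.+1 [seq y' <- L n.+1 | par y' == y].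
    move=> m; have [z] := D m.+1; rewrite addnS -addSn => Qz Ez.
    exists z => //; rewrite mem_filter -iterS Ez eqxx /=; apply: Qfin.
    exact: iter_par.
  by exists y' => _; move: y'S; rewrite mem_filter => /andP[/eqP].
pose g := fix g n := if n is n'.+1 then f (n', g n') else y0.
have Dg n : deep n (g n) by elim: n => //= n /(Hf (n, g n))[].
exists g => n; split; last by have [] := Hf (n, g n) (Dg n).
by have [z Qz <-] := Dg n 0%N; rewrite addn0 in Qz.
Qed.
End konig.

(** * Limit sets in numerical coordinates *)

Section limit_set.
Context {R : realType} (M : nat).
Hypothesis M1 : (2 <= M)%N.
Implicit Types (e : node -> bool) (b : bool) (n m k x : nat) (z : R).

Let M0 : (0 < M)%N. Proof. exact: ltnW. Qed.

Definition in_cell n x z : bool := x%:R <= z * M%:R ^+ n <= x%:R + 1.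

Definition has_cell e b n z : Prop :=
  exists2 x, x \in survivors M e b n & in_cell n x z.

Definition limit_set e b : set R := [set z | forall n, has_cell e b n z].

Lemma parent_bounds x : ((x %/ M) * M <= x)%N /\ (x.+1 <= (x %/ M).+1 * M)%N.
Proof. by split; [exact: leq_divM|exact: ltn_ceil]. Qed.

Lemma in_cell_parent n x z : in_cell n.+1 x z -> in_cell n (x %/ M) z.
Proof.
have M0' : 0 < M%:R :> R by rewrite ltr0n.
have [h1 h2] := parent_bounds x.
rewrite /in_cell exprSr mulrA => /andP[l r]; apply/andP; split.
  rewrite -(ler_pM2r M0'); apply: le_trans l; by rewrite -natrM ler_nat.
rewrite -(ler_pM2r M0'); apply: (le_trans r).
by rewrite !natr1 -natrM ler_nat.
Qed.

Lemma survivors_parent e b n x :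
  x \in survivors M e b n.+1 -> (x %/ M)%N \in survivors M e b n.
Proof.
by rewrite !mem_survivors => /andP[/= /andP[_ ->] /(ltn_parent M0)].
Qed.

Lemma has_cell_parent e b n z : has_cell e b n.+1 z -> has_cell e b n z.
Proof.
by move=> [x xs xz]; exists (x %/ M)%N; [exact: survivors_parent|exact: in_cell_parent].
Qed.

Lemma has_cell_le e b n m z : (n <= m)%N -> has_cell e b m z -> has_cell e b n z.
Proof. by move=> /subnK <-; elim: (m - n)%N => // k IH /has_cell_parent. Qed.

Lemma nested_cells (g : nat -> nat) :
  (forall n, (g n < M ^ n)%N) -> (forall n, g n.+1 %/ M = g n)%N ->
  exists z, forall n, in_cell n (g n) z.
Proof.
move=> gM gpar.
have M0' n : 0 < M%:R ^+ n :> R by rewrite exprn_gt0 // ltr0n.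
pose A : set R := [set (g n)%:R / M%:R ^+ n | n in setT].
have lo n m : (g n)%:R / M%:R ^+ n <= (g (n + m)%N)%:R / M%:R ^+ (n + m)%N :> R.
  elim: m => [|m IH]; first by rewrite addn0 lexx.
  apply: (le_trans IH); rewrite addnS exprSr invfM mulrA mulrAC.
  rewrite ler_pM2r ?invr_gt0 // ler_pdivlMr ?ltr0n //.
  by rewrite -natrM ler_nat; case: (parent_bounds (g (n + m).+1)); rewrite gpar.
have hi n m : ((g (n + m)%N)%:R + 1) / M%:R ^+ (n + m)%N <= ((g n)%:R + 1) / M%:R ^+ n :> R.
  elim: m => [|m IH]; first by rewrite addn0 lexx.
  apply: le_trans IH; rewrite addnS exprSr invfM mulrA mulrAC.
  rewrite ler_pM2r ?invr_gt0 // ler_pdivrMr ?ltr0n //.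
  by rewrite !natr1 -natrM ler_nat; case: (parent_bounds (g (n + m).+1)); rewrite gpar.
have ub n : ubound A (((g n)%:R + 1) / M%:R ^+ n).
  move=> _ [m _ <-]; apply: (le_trans (lo m n)); apply: le_trans (hi n m).
  by rewrite addnC ler_pM2r ?invr_gt0 // lerDl.
have supA : has_sup A.
  by split; [exists ((g 0%N)%:R / M%:R ^+ 0), 0%N|exists (((g 0%N)%:R + 1) / M%:R ^+ 0); exact: ub].
exists (sup A) => n; apply/andP; split.
  by rewrite -ler_pdivrMr //; apply: ub_le_sup; [exact: supA.2|exists n].
by rewrite -ler_pdivlMr //; apply: ge_sup; [exact: supA.1|exact: ub].
Qed.

(** Cells of level m of the subtree are cells of level n + m of the whole tree;
    the first levels follow by passing to parents. *)
Lemma limit_set_below e b n y z : (forall b', y b' < M ^ n)%N -> alive M e b n (y b) ->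
  limit_set (e \o below M n y) b z ->
  limit_set e b (((y b)%:R + z) / M%:R ^+ n).
Proof.
move=> yn ay H k; apply: (@has_cell_le _ _ _ (n + k)); first exact: leq_addl.
have [x] := H k; rewrite mem_survivors => /andP[ax xM] xz.
have xM' : (y b * M ^ k + x < M ^ (n + k))%N.
  rewrite expnD; exact: ltn_digit.
exists (y b * M ^ k + x)%N; first by rewrite mem_survivors alive_below // ay ax.
move: xz; rewrite /in_cell natrD natrM natrX exprD.
have Mn : M%:R ^+ n != 0 :> R by rewrite expf_neq0 // pnatr_eq0 -lt0n.
have -> : ((y b)%:R + z) / M%:R ^+ n * (M%:R ^+ n * M%:R ^+ k) =
   (y b)%:R * M%:R ^+ k + z * M%:R ^+ k by field.
by move=> /andP[l r]; rewrite lerD2l l -addrA lerD2l.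
Qed.

Lemma expn_bound_eq0 (c z : R) : (forall n, `|z| * M%:R ^+ n <= c) -> z = 0.
Proof.
move=> H; apply/eqP; rewrite -normr_eq0; apply/negP => /negP z0.
have zp : 0 < `|z| by rewrite lt_neqAle eq_sym z0 normr_ge0.
have := archi_boundP (_ : 0 <= `|c| / `|z|); rewrite divr_ge0 // => /(_ isT).
set n := Num.bound _; rewrite ltNge => /negP; apply.
rewrite ler_pdivlMr // mulrC; apply: le_trans (le_trans (H n) (ler_norm _)).
by rewrite ler_pM2l // -natrX ler_nat ltnW // ltn_expl.
Qed.

(** If the difference of two cells is within one cell of [z], then so is that of
    their parents: in units of the smaller cells, the last digits differ by
    at most M - 1, and with the error 1 this adds up to one larger cell.  An
    infinite branch of pairs then gives the two points. *)
Lemma difference_of_cells e z :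
  (forall n, exists y, (forall b, sel y b \in survivors M e b n) /\
     `|z * M%:R ^+ n - (y.2%:R - y.1%:R)| <= 1) ->
  exists z1 z2, [/\ limit_set e false z1, limit_set e true z2 & z = z2 - z1].
Proof.
move=> H.
pose Q n (y : nat * nat) := (forall b, sel y b \in survivors M e b n) /\
     `|z * M%:R ^+ n - (y.2%:R - y.1%:R)| <= 1.
pose L n := [seq (x1, x2) | x1 <- iota 0 (M ^ n), x2 <- iota 0 (M ^ n)].
have M0' : 0 < M%:R :> R by rewrite ltr0n.
have [||//|g Hg] := @konig _ L (fun y => (y.1 %/ M, y.2 %/ M)%N) Q.
- move=> n [x1 x2] [Hy _]; apply/allpairsP; exists (x1, x2).
  have := Hy false; have := Hy true; rewrite !mem_survivors !mem_iota /=.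
  by move=> /andP[_ ?] /andP[_ ?]; split.
- move=> n [x1 x2] [Hy Hz]; split.
    by case; rewrite /sel /=; [move: (Hy true)|move: (Hy false)]; apply: survivors_parent.
  move: Hz => /=; rewrite exprSr mulrA !ler_distl.
  have [a1 a2] := parent_bounds x1; have [c1 c2] := parent_bounds x2.
  move: a1 a2 c1 c2; rewrite -!(ler_nat R) !natrM -!natr1.
  set t := z * _; set m : R := M%:R in M0' *; set q1 : R := (x1 %/ M)%:R.
  set q2 : R := (x2 %/ M)%:R; set r1 : R := x1%:R; set r2 : R := x2%:R.
  move=> a1 a2 c1 c2 /andP[h1 h2].
  by apply/andP; split; rewrite -(ler_pM2r M0'); nra.
have gsel b : exists w, forall n, in_cell n (sel (g n) b) w.
  apply: nested_cells => n.
    by have [[/(_ b) + _] _] := Hg n; rewrite mem_survivors => /andP[].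
  by have [_ <-] := Hg n; case: b.
have [z1 Hz1] := gsel false; have [z2 Hz2] := gsel true.
exists z1, z2; split.
- by move=> n; exists (sel (g n) false) => //; case: (Hg n) => [[]].
- by move=> n; exists (sel (g n) true) => //; case: (Hg n) => [[]].
apply/eqP; rewrite -subr_eq0; apply/eqP; apply: (@expn_bound_eq0 2) => n.
have Mn : 0 <= M%:R ^+ n :> R by rewrite exprn_ge0 // ler0n.
rewrite -{1}(ger0_norm Mn) -normrM ler_norml.
have [[_ +] _] := Hg n; rewrite ler_distl.
move: (Hz1 n) (Hz2 n); rewrite /in_cell /sel.
set a1 : R := (g n).1%:R; set a2 : R := (g n).2%:R; set m : R := M%:R ^+ n.
by move=> /andP[h1 h2] /andP[h3 h4] /andP[h5 h6]; apply/andP; split; nra.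
Qed.

End limit_set.

(** * Identification with the percolation sets *)

Section percolation_set.
Context {d : measure_display} {T : measurableType d} {R : realType}
  (P : probability T R) (M : nat) (M1 : (2 <= M)%N)
  (X1 X2 : seq 'I_M -> {RV P >-> bool}).
Notation M0 := (ltnW M1).

Lemma aliveP (e : node -> bool) b n x :
  alive M e b n x <->
  forall k, (0 < k <= n)%N -> e (b, (k, x %/ M ^ (n - k))%N).
Proof.
elim: n x => [|n IH] x /=; first by split => // _ k; lia.
split => [/andP[ex /IH ax] k /andP[k0]|H].
  rewrite leq_eqVlt => /orP[/eqP ->|kn]; first by rewrite subnn expn0 divn1.
  have := ax k; rewrite k0 -ltnS kn => /(_ isT).
  by rewrite -divnMA -expnS subSn.
apply/andP; split; first by have := H n.+1; rewrite subnn expn0 divn1; apply; lia.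
apply/IH => k /andP[k0 kn]; have := H k; rewrite k0 leqW // => /(_ isT).
by rewrite -divnMA -expnS subSn.
Qed.

Lemma left_endpointE n (i : n.-tuple 'I_M) :
  left_endpoint i = (numeral i)%:R / M%:R ^+ n :> R.
Proof.
have M0' : M%:R != 0 :> R by rewrite pnatr_eq0 -lt0n M0.
pose x0 : 'I_M := Ordinal M0.
have H (u : seq 'I_M) : \sum_(k < size u) (nth x0 u k : nat)%:R / M%:R ^+ k.+1 =
    (numeral u)%:R / M%:R ^+ size u :> R.
  elim/last_ind: u => [|u a IH]; first by rewrite big_ord0 mul0r.
  rewrite size_rcons big_ord_recr /= nth_rcons ltnn eqxx numeral_rcons.
  rewrite (eq_bigr (fun k : 'I_(size u) => (nth x0 u k : nat)%:R / M%:R ^+ k.+1)).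
    by rewrite IH natrD natrM exprSr; field; rewrite expf_neq0 // M0'.
  by move=> k _; rewrite nth_rcons ltn_ord.
have := H i; rewrite size_tuple => <-; rewrite /left_endpoint.
by apply: eq_bigr => k _; rewrite (tnth_nth x0).
Qed.

Lemma level_intervalE n (i : n.-tuple 'I_M) (z : R) :
  level_interval i z <-> in_cell M n (numeral i) z.
Proof.
have M0' : 0 < M%:R ^+ n :> R by rewrite exprn_gt0 // ltr0n M0.
rewrite /level_interval /= in_itv /= left_endpointE /in_cell.
have -> : (numeral i)%:R / M%:R ^+ n + (M%:R ^+ n)^-1 =
  ((numeral i)%:R + 1) / M%:R ^+ n :> R by rewrite mulrDl mul1r.
by rewrite ler_pdivrMr // ler_pdivlMr.
Qed.

(** Level 0 may be included in the intersection because [0, 1] contains every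
    level 1 interval. *)
Lemma percolation_setE (b : bool) w :
  percolation_set (if b then X2 else X1) w =
  limit_set M (node_label M0 X1 X2 w) b :> set R.
Proof.
set X := if b then X2 else X1.
have E n : percolation_level X w n =
    [set z | has_cell M (node_label M0 X1 X2 w) b n z] :> set R.
  apply/seteqP; split => z.
    move=> [i ri /level_intervalE iz]; exists (numeral i) => //.
    have := numeral_lt i; rewrite size_tuple => iM.
    rewrite mem_survivors iM andbT; apply/aliveP => k kn.
    rewrite /node_label /= -take_digits; last by case/andP: kn.
    by have := numeralK M0 i; rewrite size_tuple -/X => ->; rewrite (ri k kn).
  move=> [x]; rewrite mem_survivors => /andP[/aliveP ax xM] xz.
  have sx : size (digits M0 n x) == n by rewrite size_digits.
  exists (Tuple sx); last by apply/level_intervalE; rewrite /= digitsK.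
  move=> k kn /=; rewrite take_digits; last by case/andP: kn.
  exact: ax k kn.
apply/seteqP; split => z H.
  move=> n; case: n => [|n]; last by have := H n.+1 isT; rewrite E.
  by apply: (has_cell_parent M1); have := H 1%N isT; rewrite E.
by move=> n _; rewrite E; apply: H.
Qed.
End percolation_set.

(** * First moments *)

Lemma expect_label (R : realFieldType) (p : R) (I : eqType) (i : I) s
  (e : I -> bool) : i \in s ->
  expect p s (fun e' => (e' i)%:R) e = p.
Proof.
move=> si; rewrite (@expect_sub _ _ p [:: i] _ _ e e) //=.
- by rewrite !upd_same /= mulr1 mulr0 addr0.
- by move=> e1 e2 H; rewrite H ?mem_head.
- by move=> j; rewrite inE => /eqP ->.
Qed.

Lemma expect_label2 (R : realFieldType) (p : R) (I : eqType) (i j : I) s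
  (e : I -> bool) : i != j -> i \in s -> j \in s ->
  expect p s (fun e' => (e' i)%:R * (e' j)%:R) e = p ^+ 2.
Proof.
move=> ij si sj; rewrite (@expect_sub _ _ p [:: i; j] _ _ e e) //=.
- by rewrite !upd_same !(upd_other _ _ ij) !upd_same /=; ring.
- by move=> e1 e2 H; rewrite !H ?mem_head // !inE eqxx orbT.
- by move=> k; rewrite !inE => /orP[] /eqP ->.
Qed.

Section first_moments.
Context {R : realType} (p : R) (M : nat).
Hypothesis M0 : (0 < M)%N.
Implicit Types (e : node -> bool) (b : bool) (n m k x : nat).

Lemma size_survivorsE e b n :
  (size (survivors M e b n))%:R = \sum_(0 <= x < M ^ n) (alive M e b n x)%:R :> R.
Proof. by rewrite size_filter count_iota natr_sum. Qed.

Lemma sum_parentsR e b n :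
  \sum_(0 <= x < M ^ n.+1) (alive M e b n (x %/ M))%:R =
   M%:R * (size (survivors M e b n))%:R :> R.
Proof. by rewrite -natrM -(sum_parents M0) natr_sum. Qed.

Lemma expect_size b n e :
  expect p (levels M 0 n) (fun e' => (size (survivors M e' b n))%:R) e =
  (M%:R * p) ^+ n.
Proof.
elim: n e => [|n IH] e; first by rewrite /= expr0.
rewrite -addn1 levelsD expect_cat levels1 addn1 exprS -(IH e) -expectZ.
apply: eq_expect => e' _.
rewrite (eq_expect p (Psi := fun e'' => \sum_(0 <= x < M ^ n.+1)
    (alive M e' b n (x %/ M))%:R * (e'' (b, (n.+1, x)))%:R)); last first.
  move=> e'' He; rewrite size_survivorsE; apply: eq_big_nat => x /andP[_ xM].
  by rewrite -(alive_agree M0 b xM He) /= andbC -mulnb natrM.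
rewrite expect_sum mulrAC -sum_parentsR mulr_suml; apply: eq_big_nat => x /andP[_ xM].
by rewrite expectZ expect_label // mem_level eqxx.
Qed.

Lemma expect_size2 n e :
  expect p (levels M 0 n) (fun e' =>
    (size (survivors M e' false n))%:R * (size (survivors M e' true n))%:R) e =
  ((M%:R * p) ^+ 2) ^+ n.
Proof.
elim: n e => [|n IH] e; first by rewrite /= expr0 mulr1.
rewrite -addn1 levelsD expect_cat levels1 addn1 exprS -(IH e) -expectZ.
apply: eq_expect => e' _.
rewrite (eq_expect p (Psi := fun e'' => \sum_(0 <= x < M ^ n.+1)
  \sum_(0 <= y < M ^ n.+1)
    (alive M e' false n (x %/ M))%:R * (alive M e' true n (y %/ M))%:R *
    ((e'' (false, (n.+1, x)))%:R * (e'' (true, (n.+1, y)))%:R))); last first.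
  move=> e'' He; rewrite !size_survivorsE big_distrl /=.
  apply: eq_big_nat => x /andP[_ xM]; rewrite big_distrr /=.
  apply: eq_big_nat => y /andP[_ yM].
  rewrite -(alive_agree M0 false xM He) -(alive_agree M0 true yM He) /=.
  by rewrite -!mulnb !natrM; ring.
rewrite expect_sum.
have -> : (M%:R * p) ^+ 2 * ((size (survivors M e' false n))%:R * (size (survivors M e' true n))%:R) =
  (M%:R * (size (survivors M e' false n))%:R) * (M%:R * (size (survivors M e' true n))%:R) * p ^+ 2 by ring.
rewrite -!sum_parentsR big_distrl big_distrl /=; apply: eq_big_nat => x /andP[_ xM].
rewrite expect_sum big_distrr big_distrl /=; apply: eq_big_nat => y /andP[_ yM].
by rewrite expectZ expect_label2 ?mem_level ?eqxx.
Qed.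

End first_moments.

(** * Covers and Hausdorff measure *)

Lemma powR_base_gt1 (R : realType) (M : nat) (x : R) : (2 <= M)%N -> 0 < x ->
  1 < M%:R `^ x.
Proof.
move=> M1 x0; have one : (1 : R) `^ x = 1 by rewrite powR1.
by rewrite -[ltLHS]one; apply: gt0_ltr_powR; rewrite ?nnegrE // ltr1n.
Qed.

Section covers.
Context {R : realType}.

Lemma diam_le (U : set R) (c : R) : (forall x y, U x -> U y -> `|x - y| <= c) ->
  (diam U <= c%:E)%E.
Proof. by move=> H; apply: ge_ereal_sup => _ [[x y] [/= Ux Uy] <-]; rewrite lee_fin H. Qed.

Lemma diam_ge0 (U : set R) : U !=set0 -> (0 <= diam U)%E.
Proof.
move=> [x Ux]; apply: ereal_sup_ubound; exists (x, x) => //=.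
by rewrite subrr normr0.
Qed.

Lemma diam_pow_ge0 (s : R) (U : set R) : (0 <= diam_pow s U)%E.
Proof. by rewrite /diam_pow; case: ifP => // _; apply: poweR_ge0. Qed.

Lemma diam_pow_le (s c : R) (U : set R) : 0 <= s -> 0 <= c ->
  (diam U <= c%:E)%E -> (diam_pow s U <= (c `^ s)%:E)%E.
Proof.
move=> s0 c0 Uc; rewrite /diam_pow; case: ifPn => [_|/set0P U0].
  by rewrite lee_fin powR_ge0.
rewrite -poweR_EFin; apply: gt0_ler_poweR => //; rewrite in_itv /= leey andbT //.
exact: diam_ge0.
Qed.

Lemma finite_cover_sum (s c : R) (U : nat -> set R) (N : nat) : 0 <= s -> 0 <= c ->
  (forall i, (diam (U i) <= c%:E)%E) -> (forall i, (N <= i)%N -> U i = set0) ->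
  (\sum_(0 <= i <oo) diam_pow s (U i) <= (N%:R * c `^ s)%:E)%E.
Proof.
move=> s0 c0 Uc U0; apply: lime_le; first by apply: is_cvg_nneseries => n _ _; apply: diam_pow_ge0.
apply: nearW => n; pose g i : R := if (i < N)%N then c `^ s else 0.
apply: (@le_trans _ _ (\sum_(0 <= i < n) (g i)%:E)%E).
  apply: lee_sum => i _; rewrite /g; case: ltnP => h; first exact: diam_pow_le.
  by rewrite U0 // /diam_pow eqxx.
rewrite sumEFin lee_fin.
suff -> : \sum_(0 <= i < n) g i = (minn n N)%:R * c `^ s.
  by rewrite ler_wpM2r ?powR_ge0 // ler_nat geq_minr.
elim: n => [|n IH]; first by rewrite big_nil min0n mul0r.
rewrite big_nat_recr //= IH /g; case: ltnP => h.
  by rewrite (minn_idPl h) -natr1 mulrDl mul1r.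
by rewrite (minn_idPr (leqW h)) addr0.
Qed.

(** By subadditivity of Lebesgue measure. *)
Lemma interval_cover (a b h : R) (s : seq R) : 0 <= h ->
  (forall z, a <= z <= b -> exists2 c, c \in s & `|z - c| <= h) ->
  b - a <= (size s)%:R * (h *+ 2).
Proof.
move=> h0 H; have [ba|ab] := leP b a.
  by apply: (@le_trans _ _ 0); rewrite ?subr_le0 // mulr_ge0 // mulrn_wge0.
pose B c : set R := `[c - h, c + h]%classic.
have : (lebesgue_measure (`[a, b]%classic : set R) <=
    \sum_(k < size s) lebesgue_measure (B s`_k))%E.
  apply: (@content_subadditive _ _ _ (@lebesgue_measure R) _ (fun k => B s`_k)).
  - by move=> k _; exact: measurable_itv.
  - exact: measurable_itv.
  move=> z /=; rewrite in_itv /= => /H[c cs zc].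
  suff : (\bigcup_(k in `I_(size s)) B s`_k) z by rewrite bigcup_mkord.
  exists (index c s); first by rewrite /= index_mem.
  by rewrite nth_index // /B /= in_itv /= -ler_distl.
rewrite lebesgue_measure_itv /= lte_fin ab -EFinB => K.
rewrite -lee_fin; apply: (le_trans K).
rewrite (eq_bigr (fun=> (h *+ 2)%:E)).
  by rewrite sumEFin lee_fin sumr_const card_ord mulr_natl.
move=> c _; rewrite /B lebesgue_measure_itv /= lte_fin -EFinB.
case: ltP => k; first by congr (_%:E); ring.
by congr (_%:E); rewrite mulr2n; lra.
Qed.

End covers.

Lemma powR_expN (R : realType) (a s : R) n : 0 <= a ->
  ((a ^+ n)^-1) `^ s = (a `^ (- s)) ^+ n.
Proof.
move=> a0; rewrite -powR_mulrn // -powRN -powRrM -powR_mulrn ?powR_ge0 //.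
by rewrite -powRrM; congr (_ `^ _); ring.
Qed.

(** * Upper bounds: few pairs, small Hausdorff measure *)

Section upper_bounds.
Context {d : measure_display} {T : measurableType d} {R : realType}
  (P : probability T R) (M : nat) (p : R) (Y : T -> node -> bool).
Hypotheses (p01 : 0 <= p <= 1) (hY : bernoulli_family P p (proper_node M) Y)
  (M1 : (2 <= M)%N).

Let M0 : (0 < M)%N. Proof. exact: ltnW. Qed.
Let Mr : 0 < M%:R :> R. Proof. by rewrite ltr0n. Qed.

(** An interval of length L inside the difference forces 2 Z_1 Z_2 / M^n to be
    at least L at every level, while Z_1 Z_2 / M^n has expectation
    (M p^2)^n. *)
Lemma no_interval_ae : M%:R * p ^+ 2 < 1 ->
  {ae P, forall w, forall a b : R, a < b ->
    ~ (forall z, a <= z <= b -> exists z1 z2, [/\ limit_set M (Y w) false z1,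
         limit_set M (Y w) true z2 & z = z2 - z1])}.
Proof.
move=> Mp; have p0 : 0 <= p by case/andP: p01.
pose Z e b n : R := (size (survivors M e b n))%:R.
pose W n e : R := (M%:R^-1) ^+ n * (Z e false n * Z e true n).
have W0 n e : 0 <= W n e by rewrite /W /Z !mulr_ge0 ?exprn_ge0 ?invr_ge0.
have Ws n : supported (levels M 0 n) (W n).
  by move=> e e' H; rewrite /W /Z !(supported_survivors M0 _ H).
have r01 : 0 <= M%:R * p ^+ 2 < 1 by rewrite Mp mulr_ge0 ?exprn_ge0.
have EW n : expect p (levels M 0 n) (W n) (fun=> true) <= (M%:R * p ^+ 2) ^+ n.
  rewrite expectZ expect_size2 // -exprMn le_eqVlt; apply/orP; left; apply/eqP.
  by congr (_ ^+ n); field; rewrite gt_eqF.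
have := markov_ae p01 hY Ws W0 EW (fun delta => @exp_small R _ delta r01).
apply: filterS => w H a b ab K.
have ab0 : 0 < (b - a) / 2 by rewrite divr_gt0 ?subr_gt0.
have [k Hk] := le_inv_nat ab0.
have [n _ Wn] := H k 0%N.
pose s := [seq (y.2%:R - y.1%:R) / M%:R ^+ n : R |
  y <- [seq (x1, x2) | x1 <- survivors M (Y w) false n,
                       x2 <- survivors M (Y w) true n]].
have Mn : 0 < M%:R ^+ n :> R by rewrite exprn_gt0.
have h0 : 0 <= (M%:R^-1) ^+ n :> R by rewrite exprn_ge0 // invr_ge0.
have cov z : a <= z <= b -> exists2 c, c \in s & `|z - c| <= (M%:R^-1) ^+ n.
  move=> /K[z1 [z2 [Hz1 Hz2 ->]]].
  have [x1 s1 c1] := Hz1 n; have [x2 s2 c2] := Hz2 n.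
  exists ((x2%:R - x1%:R) / M%:R ^+ n).
    apply/mapP; exists (x1, x2) => //; exact: allpairs_f.
  rewrite -(ler_pM2r Mn) exprVn mulVf ?gt_eqF // -{2}(gtr0_norm Mn) -normrM mulrBl divfK ?gt_eqF //.
  rewrite ler_norml; move: c1 c2; rewrite /in_cell mulrBl.
  by move=> /andP[? ?] /andP[? ?]; apply/andP; split; lra.
have := interval_cover h0 cov; rewrite size_map size_allpairs natrM.
move: Wn; rewrite /W /Z -/(Z _ _ _) => Wn.
set A := (size _)%:R * (size _)%:R in Wn *.
rewrite mulr2n mulrDr [A * _]mulrC => L.
have : (b - a) / 2 <= (M%:R^-1) ^+ n * A by lra.
by move=> /(lt_le_trans (lt_le_trans Wn Hk)); rewrite ltxx.
Qed.

Lemma hausdorff_measure_eq0 (s : R) (A : set R) :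
  (forall delta eps : R, 0 < delta -> 0 < eps ->
    (hausdorff_content s delta A <= eps%:E)%E) ->
  hausdorff_measure s A = 0%E.
Proof.
move=> H.
have C0 delta : 0 < delta -> hausdorff_content s delta A = 0%E.
  move=> d0; apply/eqP; rewrite eq_le; apply/andP; split.
    by apply/lee_addgt0Pr => e e0; rewrite add0e; apply: H.
  by apply: le_ereal_inf_tmp => _ [U _ <-]; apply: nneseries_ge0 => n _ _; apply: diam_pow_ge0.
apply/eqP; rewrite eq_le; apply/andP; split.
  by apply: ge_ereal_sup => _ [delta d0 <-]; rewrite C0.
by apply: ereal_sup_ubound; exists 1 => //=; apply: C0.
Qed.

(** The level [n] cells form a cover whose sum of [s]-th powers has expectation
    (M p M^-s)^n. *)
Lemma hausdorff_measure0_ae (s : R) (b : bool) : 0 <= s ->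
  M%:R * p * M%:R `^ (- s) < 1 ->
  {ae P, forall w, hausdorff_measure s (limit_set M (Y w) b : set R) = 0%E}.
Proof.
move=> s0 Mpq; have p0 : 0 <= p by case/andP: p01.
set q := M%:R `^ (- s) in Mpq; have q0 : 0 <= q by apply: powR_ge0.
pose W n e : R := q ^+ n * (size (survivors M e b n))%:R.
have W0 n e : 0 <= W n e by rewrite /W mulr_ge0 ?exprn_ge0.
have Ws n : supported (levels M 0 n) (W n).
  by move=> e e' H; rewrite /W !(supported_survivors M0 _ H).
have r01 : 0 <= M%:R * p * q < 1 by rewrite Mpq !mulr_ge0.
have EW n : expect p (levels M 0 n) (W n) (fun=> true) <= (M%:R * p * q) ^+ n.
  by rewrite expectZ expect_size // -exprMn mulrC.
have := markov_ae p01 hY Ws W0 EW (fun delta => @exp_small R _ delta r01).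
apply: filterS => w H; apply: hausdorff_measure_eq0 => delta eps d0 e0.
have [k Hk] := le_inv_nat e0.
have M1r : 0 <= (M%:R^-1 : R) < 1 by rewrite invr_ge0 ltW //= invf_lt1 // ltr1n.
have [N HN] := @exp_small R _ _ M1r d0.
have [n Nn Wn] := H k N.
pose sv := survivors M (Y w) b n.
pose U i : set R := if (i < size sv)%N then [set z | in_cell M n (nth 0%N sv i) z] else set0.
have Mn : 0 < M%:R ^+ n :> R by rewrite exprn_gt0.
have dU i : (diam (U i) <= ((M%:R ^+ n)^-1)%:E)%E.
  apply: diam_le => x y; rewrite /U; case: ifP => //= _ /andP[x1 x2] /andP[y1 y2].
  rewrite -(ler_pM2r Mn) mulVf ?gt_eqF // -{1}(gtr0_norm Mn) -normrM mulrBl ler_norml.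
  by apply/andP; split; lra.
apply: (@le_trans _ _ (\sum_(0 <= i <oo) diam_pow s (U i))%E).
  apply: ereal_inf_lbound; exists U => //; split.
    move=> z /(_ n)[x xs xz]; exists (index x sv) => //=.
    by rewrite /U index_mem xs /= nth_index.
  by move=> i; apply: (le_trans (dU i)); rewrite lee_fin -exprVn HN.
apply: (le_trans (@finite_cover_sum R s ((M%:R ^+ n)^-1) U (size sv) s0 _ dU _)).
- by rewrite invr_ge0 ltW.
- by move=> i; rewrite /U ltnNge => ->.
by rewrite lee_fin powR_expN ?(ltW Mr) // mulrC; apply/ltW/(lt_le_trans Wn).
Qed.
End upper_bounds.

(** * Columns of pairs with a given difference *)

Lemma expect_if2 (R : realFieldType) (p r : R) (I : eqType) (i j : I) (e : I -> bool) :
  i != j ->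
  expect p [:: i; j] (fun e' => if e' i && e' j then r else 1) e =
  1 - p ^+ 2 + p ^+ 2 * r.
Proof. by move=> ij; rewrite /= !upd_same !(upd_other _ _ ij) !upd_same /=; ring. Qed.

Section columns.
Context (M : nat).
Hypothesis M0 : (0 < M)%N.
Implicit Types (e : node -> bool) (n m k x N : nat).

(** The second cell is [x + k]; in the product of the two percolations the pairs
    with fixed [k] line up along a diagonal, called the column of [k] because
    they all have the same difference. *)
Definition is_pair e n k x :=
  [&& (x + k < M ^ n)%N, alive M e false n x & alive M e true n (x + k)].

Definition pairs e n k : nat := count (is_pair e n k) (iota 0 (M ^ n)).

Lemma supported_is_pair n k x : (x < M ^ n)%N ->
  supported (levels M 0 n) (fun e => is_pair e n k x).
Proof.
move=> xM e e' H; rewrite /is_pair; case: ltnP => //= xk.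
by rewrite (supported_alive M0 false xM H) (supported_alive M0 true xk H).
Qed.

Lemma supported_pairs n k : supported (levels M 0 n) (fun e => pairs e n k).
Proof.
move=> e e' H; apply: eq_in_count => x; rewrite mem_iota => xM.
exact: (supported_is_pair k xM H).
Qed.

(** The difference of the parents is [k %/ M] or its successor, according to a
    carry in the last digit; this truncated subtraction is exact. *)
Definition candidates e n k :=
  [seq x <- iota 0 (M ^ n.+1) | (x + k < M ^ n.+1)%N &&
     is_pair e n ((x + k) %/ M - x %/ M) (x %/ M)].

Lemma is_pair_parent e n k x :
  is_pair e n ((x + k) %/ M - x %/ M) (x %/ M) =
  [&& ((x + k) %/ M < M ^ n)%N, alive M e false n (x %/ M) & alive M e true n ((x + k) %/ M)].
Proof. by rewrite /is_pair subnKC // leq_div2r // leq_addr. Qed.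

Lemma pairs_candidates e n k :
  pairs e n.+1 k = count (fun x => e (false, (n.+1, x)) && e (true, (n.+1, x + k)%N))
    (candidates e n k).
Proof.
rewrite /pairs count_filter; apply: eq_in_count => x; rewrite mem_iota /= => xM.
rewrite is_pair_parent /is_pair /=; case: ltnP => xk; last by rewrite andbF.
by rewrite ltn_parent //= andbACA; case: (e _) => //; case: (e _).
Qed.

(** With k = M k' + l, there are (M - l) C(k') + l C(k' + 1) candidates, where C
    counts the pairs of level [n]: the last digit of the first coordinate
    produces a carry in [l] cases out of [M]. *)
Lemma size_candidates e n k N :
  (N <= pairs e n (k %/ M))%N ->
  ((0 < k %% M)%N -> (N <= pairs e n (k %/ M).+1)%N) ->
  (M * N <= size (candidates e n k))%N.
Proof.
move=> H0 H1; set l := (k %% M)%N in H1.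
have -> : size (candidates e n k) =
    (\sum_(0 <= a < M) pairs e n (k %/ M + (a + l) %/ M))%N.
  rewrite size_filter count_iota expnSr.
  pose F x a : nat := is_pair e n (k %/ M + (a + l) %/ M) x.
  transitivity (\sum_(0 <= x < M ^ n * M) F (x %/ M) (x %% M))%N.
    apply: eq_big_nat => x /andP[_ xM]; congr (nat_of_bool _).
    have E : ((x + k) %/ M = x %/ M + (k %/ M + (x %% M + l) %/ M))%N.
      rewrite {1}(divn_eq x M) {1}(divn_eq k M) addnACA -mulnDl divnMDl //.
      by rewrite addnA.
    rewrite E addKn -ltn_divLR // E /F /is_pair.
    by case: ltnP.
  rewrite (sum_divmod F _ M0) exchange_big_nat /=.
  by apply: eq_bigr => a _; rewrite /pairs count_iota.
rewrite -[X in (X * N)%N](subn0 M) -sum_nat_const_nat !big_seq.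
apply: leq_sum => a; rewrite mem_index_iota => /= aM.
have lM : (l < M)%N by rewrite ltn_mod.
case: (ltnP (a + l) M) => al; first by rewrite (divn_small al) addn0.
have -> : ((a + l) %/ M = 1)%N by rewrite -(subnK al) divnDr // divnn M0 divn_small //; lia.
by rewrite addn1; apply: H1; lia.
Qed.

Section growth.
Context (n0 : nat) (Nm : nat -> nat).

Definition all_open e := all e (levels M 0 n0).

(** The columns 0, ..., M^m - 1 descend from column 0 of level [n0]; column M^m is
    included because the growth of a column draws on its right neighbour. *)
Definition good e m := all (fun k => (Nm m <= pairs e (n0 + m) k)%N) (iota 0 (M ^ m).+1).

Fixpoint columns_good m e : bool :=
  if m is m'.+1 then columns_good m' e && good e m else all_open e.

Lemma supported_columns_good m : supported (levels M 0 (n0 + m)) (columns_good m).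
Proof.
elim: m => [|m IH] e e' H.
  by apply: eq_in_all => j jl; apply: H; rewrite addn0.
have sub : {subset levels M 0 (n0 + m) <= levels M 0 (n0 + m.+1)}.
  by move=> [b [k x]]; rewrite !mem_levels; lia.
rewrite /= (IH e e'); last by move=> j /sub; apply: H.
by congr (_ && _); apply: eq_all => k; rewrite (supported_pairs k H).
Qed.

Lemma open_alive e n b x : all_open e -> (n <= n0)%N -> (x < M ^ n)%N -> alive M e b n x.
Proof.
move=> /allP H; elim: n x => //= n IH x nn xM.
rewrite IH ?ltn_parent // ?(ltnW nn) // andbT; apply: H.
by rewrite mem_levels /=; lia.
Qed.

Hypothesis N0 : (Nm 0 < M ^ n0)%N.

Lemma columns_good_good m e : columns_good m e -> good e m.
Proof.
case: m => [|m]; last by move=> /= /andP[].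
move=> /= H; apply/allP => k; rewrite mem_iota expn0 addn0 /= add0n ltnS => k1.
rewrite /pairs count_iota.
apply: (@leq_trans (\sum_(0 <= x < M ^ n0 - k) 1)%N).
  by rewrite sum_nat_const_nat muln1; lia.
rewrite [leqRHS](big_cat_nat (n := (M ^ n0 - k)%N)) //=; last exact: leq_subr.
apply: (leq_trans _ (leq_addr _ _)); rewrite !big_seq; apply: leq_sum => x.
rewrite mem_index_iota /is_pair => /= xk.
by rewrite !open_alive //=; lia.
Qed.

End growth.
End columns.

(** * Uniform growth of all columns has positive probability *)

Section growth_probability.
Context {R : realType} (M : nat) (p : R).
Hypotheses (M0 : (0 < M)%N) (p01 : 0 <= p <= 1).
Implicit Types (e : node -> bool) (n m k x N : nat).

(** Within one column distinct pairs share neither coordinate, so given level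
    [n] the number of pairs in a column of level [n.+1] is a sum of
    independent Bernoulli variables of parameter [p ^+ 2], one per candidate.
    This is Markov's inequality for [r] to that number. *)
Lemma chernoff r t N e n k : 0 < r <= 1 -> (M * N <= size (candidates M e n k))%N ->
  r ^+ t * expect p (level M n.+1) (fun e' => (pairs M e' n.+1 k < t)%N%:R) e <=
  gw M (p ^+ 2) r ^+ N.
Proof.
move=> /andP[r0 r1] HN; have /andP[p0 p1] := p01.
have p2 : 0 <= p ^+ 2 <= 1 by rewrite exprn_ge0 ?exprn_ile1.
pose F x e' : R := if e' (false, (n.+1, x)) && e' (true, (n.+1, x + k)%N) then r else 1.
have cand_inv e' : (forall j, j \notin level M n.+1 -> e' j = e j) ->
    candidates M e' n k = candidates M e n k.
  move=> He; apply: eq_in_filter => x; rewrite mem_iota => /= xM.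
  case: ltnP => //= xk; apply: (supported_is_pair M0 _ (ltn_parent M0 xM)).
  by move: He; rewrite -levels1; apply: agree_levels.
have cand_lt x : x \in candidates M e n k -> (x < M ^ n.+1)%N /\ (x + k < M ^ n.+1)%N.
  by rewrite mem_filter mem_iota => /andP[/andP[? _] ?].
rewrite -expectZ.
apply: (@le_trans _ _ (expect p (level M n.+1) (fun e' => \prod_(x <- candidates M e n k) F x e') e)).
  apply: ler_expect => // e' He'.
  rewrite pairs_candidates // (cand_inv e' He').
  have -> : \prod_(x <- candidates M e n k) F x e' = r ^+
      count (fun x => e' (false, (n.+1, x)) && e' (true, (n.+1, x + k)%N)) (candidates M e n k).
    elim: (candidates M e n k) => [|x s IH]; first by rewrite big_nil.
    by rewrite big_cons IH /= /F; case: ifP => _; rewrite ?mul1r // exprS.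
  case: ltnP => h; last by rewrite mulr0 exprn_ge0 // ltW.
  by rewrite mulr1; apply: ler_wiXn2l; [exact: ltW|exact: r1|exact: ltnW].
rewrite (expect_blocks p (blk := fun x => [:: (false, (n.+1, x)); (true, (n.+1, x + k)%N)])).
- apply: (@le_trans _ _ (\prod_(x <- candidates M e n k) (1 - p ^+ 2 + p ^+ 2 * r))).
    rewrite le_eqVlt; apply/orP; left; apply/eqP; apply: eq_bigr => x _.
    exact: expect_if2.
  rewrite big_const_seq count_predT iter_mulr_1 /gw -exprM.
  by apply: ler_wiXn2l => //; nra.
- exact/filter_uniq/iota_uniq.
- by move=> x _ e1 e2 H; rewrite /F !H // !inE eqxx ?orbT.
- move=> x y _ _ j; rewrite !inE => /orP[] /eqP -> /orP[] /eqP [] //.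
  by move=> /addIn.
- move=> x /cand_lt[? ?] j; rewrite !inE => /orP[] /eqP ->; by rewrite mem_level eqxx.
Qed.

Context (n0 : nat) (Nm : nat -> nat).
Hypothesis N0 : (Nm 0 < M ^ n0)%N.

Context (r : R).
Hypotheses (r01 : 0 < r <= 1)
  (Nstep : forall m, (M%:R ^+ m.+1 + 1) * gw M (p ^+ 2) r ^+ Nm m <=
     (2^-1) ^+ m.+2 * r ^+ Nm m.+1).

(** A column of level [n0 + m.+1] receives at least [M * Nm m] candidates from
    two adjacent good columns; a union bound over the [M ^ m.+1 + 1] columns
    concludes. *)
Lemma columns_good_step m e : columns_good M n0 Nm m e ->
  expect p (level M (n0 + m).+1) (fun e' => (~~ good M n0 Nm e' m.+1)%:R) e <= (2^-1) ^+ m.+2.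
Proof.
move=> H; have G := columns_good_good M0 N0 H.
have /andP[r0 r1] := r01.
apply: (@le_trans _ _ (\sum_(k <- iota 0 (M ^ m.+1).+1)
   expect p (level M (n0 + m).+1) (fun e' => (pairs M e' (n0 + m).+1 k < Nm m.+1)%N%:R) e)).
  rewrite -expect_sum; apply: ler_expect => // e' _.
  case: (boolP (good M n0 Nm e' m.+1)) => /= [_|]; first by apply: sumr_ge0 => k _; rewrite ler0n.
  rewrite -has_predC => /hasP[k ki]; rewrite /= -ltnNge addnS => kN.
  rewrite (big_rem k) //= kN lerDl; apply: sumr_ge0 => k' _; exact: ler0n.
rewrite -(ler_pM2r (exprn_gt0 (Nm m.+1) r0)); apply: le_trans (Nstep m).
rewrite mulr_suml.
apply: (@le_trans _ _ (\sum_(k <- iota 0 (M ^ m.+1).+1) gw M (p ^+ 2) r ^+ Nm m)).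
  rewrite !big_seq; apply: ler_sum => k; rewrite mem_iota add0n => /= kM.
  rewrite mulrC; apply: chernoff => //; apply: (size_candidates M0).
    apply: (allP G); rewrite mem_iota add0n /= ltnS -(mulnK (M ^ m) M0) -expnSr.
    exact: leq_div2r.
  move=> l0; apply: (allP G); rewrite mem_iota add0n /= ltnS.
  rewrite ltn_divLR // -expnSr; move: kM l0; rewrite ltnS leq_eqVlt.
  by move=> /orP[/eqP ->|//]; rewrite expnSr modnMl.
by rewrite big_const_seq count_predT size_iota iter_addr_0 -[leLHS]mulr_natl -[X in X * _ <= _]natr1 natrX.
Qed.

(** The losses at the successive levels are at most 1/4, 1/8, ... of the
    probability of [all_open].  The comparison is with that probability, tiny
    as it may be, because the step estimates hold conditionally. *)
Lemma expect_columns_good m e :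
  expect p (levels M 0 n0) (fun e' => (all_open M n0 e')%:R) e * (2^-1 + (2^-1) ^+ m.+1) <=
  expect p (levels M 0 (n0 + m)) (fun e' => (columns_good M n0 Nm m e')%:R) e.
Proof.
set P0 := expect _ _ _ _.
have sR0 : supported (levels M 0 n0) (fun e' => (all_open M n0 e')%:R : R).
  by move=> e1 e2 H; rewrite /all_open (eq_in_all H).
have P0E m' : expect p (levels M 0 (n0 + m')) (fun e' => (all_open M n0 e')%:R) e = P0.
  by apply: (expect_sub p e e sR0) => -[b [k x]]; rewrite !mem_levels; lia.
elim: m => [|m IH]; first by rewrite /= addn0 -/P0 expr1; lra.
rewrite addnS -[(n0 + m).+1]addn1 levelsD expect_cat levels1.
apply: (@le_trans _ _ (expect p (levels M 0 (n0 + m))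
   (fun e' => (columns_good M n0 Nm m e')%:R + - (2^-1) ^+ m.+2 * (all_open M n0 e')%:R) e)).
  rewrite expectD expectZ P0E; move: IH; rewrite [(_ ^+ m.+2)%R]exprS; lra.
apply: ler_expect => // e' _.
have key : expect p (level M (n0 + m).+1) (fun e'' => (columns_good M n0 Nm m.+1 e'')%:R) e' =
   (columns_good M n0 Nm m e')%:R * (1 + - 1 * expect p (level M (n0 + m).+1) (fun e'' => (~~ good M n0 Nm e'' m.+1)%:R) e').
  rewrite -[X in _ * (X + _)](expect_cst p (level M (n0 + m).+1) 1 e') -expectZ -expectD -expectZ.
  apply: eq_expect => e'' He /=.
  have -> : columns_good M n0 Nm m e'' = columns_good M n0 Nm m e'.
    by apply: (supported_columns_good M0); move: He; rewrite -levels1; apply: agree_levels.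
  by case: (columns_good M n0 Nm m e'); case: (good _ _ _ _ _) => /=; ring.
rewrite key; case: (boolP (columns_good M n0 Nm m e')) => [H|_] /=; last first.
  by rewrite mul0r add0r mulNr oppr_le0 mulr_ge0 // exprn_ge0.
have -> : all_open M n0 e' by elim: m H {IH key} => //= m IH /andP[/IH].
by rewrite mul1r mulr1 mulN1r lerD2l lerN2; apply: columns_good_step.
Qed.

End growth_probability.

(** It is enough that the thresholds grow linearly, as [K * (m0 + m)], with [m0]
    and [K] large: when [r] is chosen with gw r < r, a failure at step [m] has
    probability at most (gw r / r)^(Nm m) r^-K, which beats the number M^m of
    columns.  The choice of [m0] absorbs the factor r^-K. *)
Lemma growth_parameters (R : realType) (M : nat) (p : R) :
  (2 <= M)%N -> 0 <= p <= 1 -> 1 < M%:R * p ^+ 2 ->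
  exists r n0 Nm, [/\ 0 < r <= 1, (Nm 0%N < M ^ n0)%N, (forall m, (0 < Nm m)%N) &
    forall m, (M%:R ^+ m.+1 + 1) * gw M (p ^+ 2) r ^+ Nm m <=
     (2^-1) ^+ m.+2 * r ^+ Nm m.+1].
Proof.
move=> M1 /andP[p0 p1] Mp.
have p2 : 0 <= p ^+ 2 <= 1 by rewrite exprn_ge0 ?exprn_ile1.
have [d0 /andP[d00 d01] Hd] := gw_below p2 Mp.
have [r [r0 r1 Gr]] : exists r : R, [/\ 0 < r, r <= 1 & gw M (p ^+ 2) r < r].
  exists (1 - d0 / 2); split; [lra|lra|]; apply: Hd; apply/andP; split; lra.
set g := gw M (p ^+ 2) r in Gr *.
have g0 : 0 <= g by apply: gw_ge0 => //; exact: ltW.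
have s01 : 0 <= g / r < 1 by rewrite divr_ge0 ?(ltW r0) // ltr_pdivrMr // mul1r.
set s := g / r in s01; have /andP[s0 s1] := s01.
have [m0 Hm0] := @exp_small R s (r / 4) s01 (divr_gt0 r0 (ltr0n _ 4)).
have {}Hm0 : s ^+ m0.+1 <= r / 4 by apply: Hm0.
have q01 : 0 <= (4^-1 : R) < 1 by lra.
have MR : 0 < M%:R :> R by rewrite ltr0n ltnW.
have [K1 HK1] := @exp_small R _ (1 / (8 * M%:R)) q01 (divr_gt0 ltr01 (mulr_gt0 (ltr0n _ 8) MR)).
have [K2 HK2] := @exp_small R s (1 / (2 * M%:R)) s01 (divr_gt0 ltr01 (mulr_gt0 (ltr0n _ 2) MR)).
pose K := (maxn K1 K2).+1.
have {}HK1 : (4^-1) ^+ K <= 1 / (8 * M%:R) :> R by apply: HK1; rewrite /K leqW // leq_maxl.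
have {}HK2 : s ^+ K <= 1 / (2 * M%:R) by apply: HK2; rewrite /K leqW // leq_maxr.
pose Nm m := (K * (m0.+1 + m))%N.
exists r, (Nm 0%N), Nm; split.
- by rewrite r0.
- exact: ltn_expl.
- by move=> m; rewrite /Nm muln_gt0 addSn.
move=> m.
have -> : g ^+ Nm m = s ^+ Nm m * r ^+ Nm m by rewrite -exprMn divfK // gt_eqF.
have -> : Nm m.+1 = (Nm m + K)%N by rewrite /Nm addnS mulnS addnC.
rewrite exprD mulrA [leRHS]mulrCA [leRHS]mulrC ler_pM2r ?exprn_gt0 //.
have -> : s ^+ Nm m = (s ^+ m0.+1) ^+ K * (s ^+ K) ^+ m.
  by rewrite -!exprM -exprD /Nm mulnDr [(m0.+1 * K)%N]mulnC.
have HA : (s ^+ m0.+1) ^+ K <= r ^+ K * (4^-1) ^+ K.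
  by rewrite -exprMn; apply: lerXn2r; rewrite ?nnegrE ?exprn_ge0 // divr_ge0 // ltW.
have HB : (s ^+ K) ^+ m <= (1 / (2 * M%:R)) ^+ m.
  apply: lerXn2r HK2; rewrite nnegrE; first exact: exprn_ge0.
  by rewrite divr_ge0 // mulr_ge0 // ltW.
have HM : M%:R ^+ m.+1 + 1 <= 2 * M%:R * M%:R ^+ m :> R.
  rewrite -mulrA -exprS mulr_natl mulr2n lerD2l exprn_ege1 //.
  by rewrite ler1n ltnW.
have HK : (s ^+ m0.+1) ^+ K <= r ^+ K * (1 / (8 * M%:R)).
  by apply: (le_trans HA); rewrite ler_wpM2l // exprn_ge0 // ltW.
have rK : 0 < r ^+ K by rewrite exprn_gt0.
apply: (@le_trans _ _ (2 * M%:R * M%:R ^+ m * (r ^+ K * (1 / (8 * M%:R)) * (1 / (2 * M%:R)) ^+ m))).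
  have sK n : 0 <= s ^+ n by apply: exprn_ge0.
  apply: ler_pM HM _; first by rewrite addr_ge0 // exprn_ge0 // ltW.
    by apply: mulr_ge0; apply: exprn_ge0.
  by apply: ler_pM HK HB; apply: exprn_ge0.
rewrite le_eqVlt; apply/orP; left; apply/eqP.
have -> : 1 / (2 * M%:R) = 2^-1 * M%:R^-1 :> R by field; rewrite gt_eqF.
have My : M%:R ^+ m != 0 :> R by rewrite expf_neq0 // gt_eqF.
rewrite exprMn 2!(exprS 2^-1) (exprVn M%:R).
set x : R := 2^-1 ^+ m; set y : R := M%:R ^+ m in My *; set u : R := r ^+ K.
by field; rewrite My gt_eqF.
Qed.

(** [z] lies within one cell of the column of the integer part of z M^n, which
    contains a pair at every level. *)
Lemma interval_of_columns (R : realType) (M : nat) e n0 (Nm : nat -> nat) (z : R) :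
  (2 <= M)%N -> (Nm 0%N < M ^ n0)%N -> (forall m, (0 < Nm m)%N) ->
  (forall m, columns_good M n0 Nm m e) -> 0 <= z * M%:R ^+ n0 <= 1 ->
  exists z1 z2, [/\ limit_set M e false z1, limit_set M e true z2 & z = z2 - z1].
Proof.
move=> M1 N0 Npos H /andP[z0 z1]; have M0 : (0 < M)%N by apply: ltnW.
have MR n : 0 < M%:R ^+ n :> R by rewrite exprn_gt0 // ltr0n.
(* up to level n0, where every node is alive, the pair (0, 0) is close enough *)
apply: (difference_of_cells M1) => n; case: (leqP n n0) => [nn|/ltnW nn].
  have op := H 0%N; exists (0%N, 0%N); split.
    by move=> b; rewrite mem_survivors (open_alive M0 (n0 := n0)) //=; case: b; rewrite /= expn_gt0 M0.
  have zp : 0 <= z by rewrite -(pmulr_lge0 _ (MR n0)).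
  rewrite /= subr0 subr0 ger0_norm ?mulr_ge0 ?(ltW (MR n)) //; apply: le_trans z1.
  by rewrite ler_wpM2l // ler_weXn2l // ler1n.
set m := (n - n0)%N; have En : n = (n0 + m)%N by rewrite subnKC.
set t := z * M%:R ^+ n.
have t0 : 0 <= t.
  by rewrite /t mulr_ge0 ?(ltW (MR n)) // -(pmulr_lge0 _ (MR n0)).
have tM : t <= M%:R ^+ m.
  by rewrite /t En exprD mulrA -[leRHS]mul1r ler_wpM2r // ltW.
have := truncn_itv t0; set k := Num.truncn t => /andP[k1 k2].
have kM : (k <= M ^ m)%N by rewrite -(ler_nat R) natrX (le_trans k1).
have := allP (columns_good_good M0 N0 (H m)) k; rewrite mem_iota add0n ltnS kM => /(_ isT).
move=> /(leq_trans (Npos m)); rewrite -has_count -En => /hasP[x].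
rewrite mem_iota /= add0n => xM /and3P[xk a1 a2].
exists (x, x + k)%N; split.
  by case; rewrite mem_survivors /= ?a1 ?a2.
rewrite natrD -/t /=.
have -> : t - (x%:R + k%:R - x%:R) = t - k%:R by ring.
by rewrite ger0_norm ?subr_ge0 // lerBlDl natr1 ltW.
Qed.

(** * The difference contains an interval almost surely *)

Section interval_ae.
Context {d : measure_display} {T : measurableType d} {R : realType}
  (P : probability T R) (M : nat) (p : R) (Y : T -> node -> bool).
Hypotheses (p01 : 0 <= p <= 1) (hY : bernoulli_family P p (proper_node M) Y)
  (M1 : (2 <= M)%N).

(** The growth of all columns gives the interval [0, M^-n0] below some pair of
    survivors by [zero_one_ae]; it is then rescaled. *)
Lemma interval_ae : 1 < M%:R * p ^+ 2 ->
  {ae P, forall w, (forall b n, survivors M (Y w) b n != [::]) ->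
    exists a c : R, a < c /\ forall u, a <= u <= c ->
      exists z1 z2, [/\ limit_set M (Y w) false z1, limit_set M (Y w) true z2 & u = z2 - z1]}.
Proof.
move=> Mpp; have /andP[p0 p1] := p01; have M0 : (0 < M)%N by apply: ltnW.
have MR n : 0 < M%:R ^+ n :> R by rewrite exprn_gt0 // ltr0n.
have ppos : 0 < p.
  by rewrite lt_neqAle p0 andbT; apply: contraTneq Mpp => <-; rewrite expr0n mulr0 ltr10.
have Mp : 1 < M%:R * p.
  by apply: (lt_le_trans Mpp); rewrite ler_wpM2l // expr2 ler_piMr.
have [r [n0 [Nm [r01 N0 Npos Nstep]]]] := growth_parameters M1 p01 Mpp.
(* shifted by n0, so that level m determines the event Phi m *)
pose Phi m e := if (n0 <= m)%N then columns_good M n0 Nm (m - n0) e else true.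
pose eps := p ^+ size (levels M 0 n0) / 2.
have Pe e : p ^+ size (levels M 0 n0) <= expect p (levels M 0 n0) (fun e' => (all_open M n0 e')%:R) e.
  by apply: expect_all_true => // e' He' _; rewrite /all_open (introT allP).
have pos : 0 < p ^+ size (levels M 0 n0) by rewrite exprn_gt0.
have Ple e : expect p (levels M 0 n0) (fun e' => (all_open M n0 e')%:R) e <= 1.
  by rewrite -[leRHS](expect_cst p (levels M 0 n0) 1 e); apply: ler_expect => // e' _; rewrite lern1 leq_b1.
have := @zero_one_ae _ _ _ P M p Y p01 hY Phi eps M1 Mp.
have h1 : 0 < eps by rewrite divr_gt0.
have h2 m : supported (levels M 0 m) (Phi m).
  rewrite /Phi; case: leqP => // h; rewrite -{1}(subnKC h).
  exact: (supported_columns_good M0).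
have h3 m e : Phi m.+1 e -> Phi m e.
  rewrite /Phi; case: (leqP n0 m) => h //; rewrite leqW // subSn //=.
  by case/andP.
have h4 m e : eps <= expect p (levels M 0 m) (fun e' => (Phi m e')%:R) e.
  rewrite /Phi; case: leqP => h.
    rewrite -[in levels _ _ _](subnKC h).
    apply: le_trans (expect_columns_good M0 p01 N0 r01 Nstep (m - n0) e).
    rewrite /eps; have := exprn_ge0 (m - n0).+1 (_ : 0 <= (2^-1 : R)).
    rewrite invr_ge0 ler0n => /(_ isT) q0; have := Pe e.
    set a := p ^+ _; set b := expect _ _ _ _; set q := _ ^+ _ in q0 *.
    by move=> ab; have : 0 <= b * q; [rewrite mulr_ge0 // (le_trans _ ab) // ltW|lra].
  rewrite expect_cst /eps /= mulr1n; have := le_trans (Pe e) (Ple e); lra.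
move=> /(_ h1 h2 h3 h4); apply: filterS => w H /H[n [y [Hy HPhi]]].
have HG m : columns_good M n0 Nm m (Y w \o below M n (sel y)).
  by have := HPhi (n0 + m)%N; rewrite /Phi leq_addr addKn.
have yM b : (sel y b < M ^ n)%N by have := Hy b; rewrite mem_survivors => /andP[].
have ya b : alive M (Y w) b n (sel y b) by have := Hy b; rewrite mem_survivors => /andP[].
pose a : R := (y.2%:R - y.1%:R) / M%:R ^+ n.
exists a, (a + 1 / M%:R ^+ n0 / M%:R ^+ n); split.
  by rewrite ltrDl !divr_gt0.
move=> u /andP[u1 u2].
have := @interval_of_columns R M _ n0 Nm ((u - a) * M%:R ^+ n) M1 N0 Npos HG.
case.
  apply/andP; split; first by rewrite !mulr_ge0 ?subr_ge0 // ltW.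
  by rewrite -ler_pdivlMr // -ler_pdivlMr // lerBlDl.
move=> z1 [z2 [Hz1 Hz2 E]].
exists ((y.1%:R + z1) / M%:R ^+ n), ((y.2%:R + z2) / M%:R ^+ n); split.
- exact: (limit_set_below M1 yM (ya false)).
- exact: (limit_set_below M1 yM (ya true)).
have Mn : M%:R ^+ n != 0 :> R by rewrite gt_eqF.
have -> : u = a + (z2 - z1) / M%:R ^+ n by rewrite -E mulfK // addrC subrK.
by rewrite /a; field.
Qed.
End interval_ae.

(** * Thinning a tree and cut sets *)

Lemma prod_sub1_bounds (R : realFieldType) (I : Type) (r : seq I) (z : I -> R) :
  (forall i, 0 <= z i <= 1) -> 0 <= \prod_(i <- r) (1 - z i) <= 1.
Proof.
move=> z01; elim: r => [|i r /andP[IH0 IH1]]; first by rewrite big_nil ler01 lexx.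
have /andP[z0 z1] := z01 i; rewrite big_cons; apply/andP; split; first by rewrite mulr_ge0 ?subr_ge0.
by rewrite mulr_ile1 ?subr_ge0 // gerBl.
Qed.

Lemma union_bound (R : realFieldType) (I : Type) (r : seq I) (z : I -> R) :
  (forall i, 0 <= z i <= 1) -> 1 - \prod_(i <- r) (1 - z i) <= \sum_(i <- r) z i.
Proof.
move=> z01; elim: r => [|i r IH]; first by rewrite !big_nil subrr.
have /andP[q0 q1] := prod_sub1_bounds r z01.
by have /andP[z0 z1] := z01 i; rewrite !big_cons; nra.
Qed.

Lemma union_ge (R : realFieldType) (I : eqType) (r : seq I) (z : I -> R) i :
  (forall i, 0 <= z i <= 1) -> i \in r -> z i <= 1 - \prod_(i <- r) (1 - z i).
Proof.
move=> z01 ir; rewrite (big_rem i) //=.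
have /andP[q0 q1] := prod_sub1_bounds (rem i r) z01.
by have /andP[z0 z1] := z01 i; nra.
Qed.

Section persistence.
Context {R : realType} (M : nat) (q : R).
Hypotheses (M0 : (0 < M)%N) (q01 : 0 <= q <= 1).
Implicit Types (e : node -> bool) (t : nat * nat -> bool) (n m k x a : nat).

Definition sub_tree n y t : nat * nat -> bool :=
  fun v => t (n + v.1, y * M ^ v.1 + v.2)%N.

(** The probability that the tree [t], thinned by keeping each node
    independently with probability [q], reaches level [n].  The recursion
    over the children of the root replaces a second source of randomness. *)
Fixpoint persist n t : R :=
  if n is n'.+1 then
    1 - \prod_(0 <= a < M) (1 - q * (t (1%N, a))%:R * persist n' (sub_tree 1 a t))
  else 1.

Lemma persist01 n t : 0 <= persist n t <= 1.
Proof.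
elim: n t => [|n IH] t /=; first by rewrite ler01 lexx.
have z01 a : 0 <= q * (t (1%N, a))%:R * persist n (sub_tree 1 a t) <= 1.
  have /andP[q0 q1] := q01; have /andP[f0 f1] := IH (sub_tree 1 a t).
  by case: (t _); rewrite ?mulr1 ?mulr0 ?mul0r ?lexx ?ler01 // mulr_ge0 // mulr_ile1.
by have /andP[h0 h1] := prod_sub1_bounds (index_iota 0 M) z01; rewrite subr_ge0 h1 gerBl h0.
Qed.

Lemma factor01 n t a : 0 <= q * (t (1%N, a))%:R * persist n (sub_tree 1 a t) <= 1.
Proof.
have /andP[q0 q1] := q01; have /andP[f0 f1] := persist01 n (sub_tree 1 a t).
by case: (t _); rewrite ?mulr1 ?mulr0 ?mul0r ?lexx ?ler01 // mulr_ge0 // mulr_ile1.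
Qed.

Lemma persist_decr n t : persist n.+1 t <= persist n t.
Proof.
elim: n t => [|n IH] t; first by have /andP[] := persist01 1 t.
rewrite [leLHS]/= [leRHS]/= lerD2l lerN2; apply: ler_prod => a _.
have /andP[h0 h1] := factor01 n t a; have /andP[q0 _] := q01.
rewrite subr_ge0 h1 lerD2l lerN2; apply: ler_wpM2l; last exact: IH.
by rewrite mulr_ge0.
Qed.

Lemma persist_child n t a : (a < M)%N ->
  q * (t (1%N, a))%:R * persist n (sub_tree 1 a t) <= persist n.+1 t.
Proof.
move=> aM; apply: (@union_ge R _ (index_iota 0 M)
  (fun a => q * (t (1%N, a))%:R * persist n (sub_tree 1 a t))); first exact: factor01.
by rewrite mem_index_iota.
Qed.

Lemma sub_tree_sub n m y x t :
  sub_tree n x (sub_tree m y t) = sub_tree (m + n)%N (y * M ^ n + x)%N t.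
Proof.
apply/funext => v; rewrite /sub_tree /= !addnA; congr (t (_, _)).
by rewrite expnD mulnDl !mulnA.
Qed.

(** The thinned tree may survive by keeping the path to [y] and then surviving
    below [y]. *)
Lemma persist_below n m e b y : (y < M ^ n)%N -> alive M e b n y ->
  q ^+ n * persist m (sub_tree n y (fun v => e (b, v))) <=
  persist (n + m)%N (fun v => e (b, v)).
Proof.
elim: n e y => [|n IH] e y yM ay.
  case: y yM {ay} => // _; rewrite expr0 mul1r add0n.
  by have -> : sub_tree 0 0 (fun v => e (b, v)) = (fun v => e (b, v)) by apply/funext => -[? ?].
set t := fun v => e (b, v).
have Mn : (0 < M ^ n)%N by rewrite expn_gt0 M0.
have Ey : y = ((y %/ M ^ n) * M ^ n + y %% M ^ n)%N by exact: divn_eq.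
set a := (y %/ M ^ n)%N in Ey; set y' := (y %% M ^ n)%N in Ey.
have aM : (a < M)%N by rewrite ltn_divLR // -expnS.
have yM' : (y' < M ^ n)%N by rewrite ltn_mod.
have := ay; rewrite Ey -(add1n n) (alive_below M0 e b 1 (fun=> a) yM') /= => /andP[/andP[ta _] ay'].
have := IH _ _ yM' ay'; rewrite -/t => H.
rewrite -sub_tree_sub; apply: le_trans (persist_child (n + m)%N t aM).
rewrite /t ta mulr1 exprS -mulrA ler_wpM2l //; by have /andP[] := q01.
Qed.

(** If every surviving node of level [n] has an ancestor in [L], then so has
    every node of the thinned tree, and a given node of level k is reached
    with probability at most q^k. *)
Lemma persist_cut n e b (L : seq (nat * nat)) :
  (forall x, x \in survivors M e b n ->
     exists2 k, (k <= n)%N & (k, x %/ M ^ (n - k))%N \in L) ->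
  persist n (fun v => e (b, v)) <= \sum_(v <- L) q ^+ v.1.
Proof.
have /andP[q0 q1] := q01.
have pos (L' : seq (nat * nat)) : 0 <= \sum_(v <- L') q ^+ v.1.
  by apply: sumr_ge0 => v _; rewrite exprn_ge0.
have root (L' : seq (nat * nat)) m t y : (0%N, y) \in L' -> persist m t <= \sum_(v <- L') q ^+ v.1.
  move=> h; have /andP[_ f1] := persist01 m t; apply: (le_trans f1).
  by rewrite (big_rem _ h) /= expr0 lerDl.
elim: n e L => [|n IH] e L H.
  have [|k] := H 0%N; first by rewrite mem_survivors /= expn0.
  by rewrite leqn0 => /eqP -> /root; apply.
have [/hasP[[k y] kL /eqP k0]|/hasPn L1] := boolP (has (fun v => v.1 == 0%N) L).
  by rewrite -[k]/((k, y).1) k0 in kL; exact: (root _ _ _ _ kL).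
set t := fun v => e (b, v).
have := @union_bound R _ (index_iota 0 M) _ (factor01 n t); move/le_trans; apply.
pose parent_at a (v : nat * nat) := (v.2 %/ M ^ v.1.-1 == a)%N.
apply: (@le_trans _ _ (\sum_(0 <= a < M) \sum_(v <- L | parent_at a v) q ^+ v.1)).
  rewrite !big_seq; apply: ler_sum => a; rewrite mem_index_iota => /= aM.
  case ta : (t (1%N, a)); last by rewrite mulr0 mul0r; apply: sumr_ge0 => v _; rewrite exprn_ge0.
  rewrite mulr1.
  (* the part of the cut below child a, seen from a *)
  pose La := [seq (v.1.-1, v.2 %% M ^ v.1.-1)%N | v <- L & parent_at a v].
  have cutL x : x \in survivors M (e \o below M 1 (fun=> a)) b n ->
      exists2 k, (k <= n)%N & (k, x %/ M ^ (n - k))%N \in La.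
    rewrite mem_survivors => /andP[ax xM].
    have [|k kn kL] := H (a * M ^ n + x)%N.
      rewrite mem_survivors -{1}(add1n n) (alive_below M0 e b 1 (fun=> a) xM) ax andbT.
      rewrite /= -/(t (1%N, a)) ta /= expnS.
      exact: ltn_digit.
    have := L1 _ kL; case: k kn kL => // k kn kL _; exists k => //.
    have Mk j : (0 < M ^ j)%N by rewrite expn_gt0 M0.
    have Ey : ((a * M ^ n + x) %/ M ^ (n.+1 - k.+1) = a * M ^ k + x %/ M ^ (n - k))%N.
      by rewrite subSS -{1}(subnKC (kn : k <= n)%N) expnD mulnA divnMDl.
    have xk : (x %/ M ^ (n - k) < M ^ k)%N by rewrite ltn_divLR // -expnD subnKC.
    rewrite Ey in kL; apply/mapP; exists (k.+1, a * M ^ k + x %/ M ^ (n - k))%N.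
      by rewrite mem_filter kL andbT /parent_at /= divnMDl // divn_small // addn0.
    by rewrite /= modnMDl modn_small.
  have := ler_wpM2l q0 (IH _ _ cutL); rewrite big_map big_filter => K.
  apply: (le_trans K); rewrite mulr_sumr le_eqVlt; apply/orP; left; apply/eqP.
  rewrite big_seq_cond [RHS]big_seq_cond; apply: eq_bigr => v /andP[/L1 v1 _] /=.
  by rewrite -exprS prednK // lt0n.
rewrite (exchange_big_dep xpredT) //=; apply: ler_sum => v _.
have one (w : R) c N : \sum_(0 <= a < N | (c == a)%N) w = if (c < N)%N then w else 0.
  rewrite big_mkcond; elim: N => [|N IHN]; first by rewrite big_nil.
  rewrite big_nat_recr //= IHN ltnS [(c <= N)%N]leq_eqVlt.
  by case: (ltngtP c N) => //= _; rewrite ?addr0 ?add0r.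
rewrite one; case: ifP => // _; exact: exprn_ge0.
Qed.

End persistence.

(** * Expected persistence *)

Lemma supported_persist (R : realType) (M : nat) (q : R) n b : (0 < M)%N ->
  supported (levels M 0 n) (fun e => persist M q n (fun v => e (b, v))).
Proof.
move=> M0; elim: n => [//|n IH] e e' H /=; congr (1 - _).
apply: eq_big_nat => a /andP[_ aM]; rewrite H; last first.
  by rewrite mem_levels /= expn1.
congr (1 - _ * _).
apply: (IH (e \o below M 1 (fun=> a)) (e' \o below M 1 (fun=> a))) => j jn /=.
apply: H.
case: j jn => b' [k x]; rewrite !mem_levels /= => /and3P[k0 kn xM].
apply/andP; split; [lia|]; rewrite expnD expn1.
exact: ltn_digit.
Qed.

Section expected_persistence.
Context {R : realType} (M : nat) (p q : R).
Hypotheses (M0 : (0 < M)%N) (p01 : 0 <= p <= 1) (q01 : 0 <= q <= 1).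
Implicit Types (e : node -> bool) (b : bool) (n m k x a : nat).

Notation pers n b e := (persist M q n (fun v => e (b, v))).

(** Averaging over the labels too, the thinned tree is a percolation of
    parameter [p * q]; a number [delta] as in the hypothesis is a lower bound
    for its survival probability at every level, by induction on the level. *)
Lemma expect_persist delta n b e : 0 <= delta <= 1 ->
  gw M (p * q) (1 - delta) <= 1 - delta ->
  delta <= expect p (levels M 0 n) (fun e' => pers n b e') e.
Proof.
move=> /andP[d0 d1] Hd; have /andP[p0 p1] := p01; have /andP[q0 q1] := q01.
elim: n e => [//|n IH] e.
pose u := expect p (levels M 0 n) (fun e' => pers n b e') e.
have uE e' : expect p (levels M 0 n) (fun e' => pers n b e') e' = u.
  by apply: (expect_sub p e' e (@supported_persist R M q n b M0)).
have u1 : u <= 1.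
  rewrite -[leRHS](expect_cst p (levels M 0 n) 1 e); apply: ler_expect => // e' _.
  by have /andP[] := persist01 M q01 n (fun v => e' (b, v)).
have du : delta <= u by apply: IH.
pose F a e' : R := 1 - q * (e' (b, (1%N, a)))%:R * pers n b (e' \o below M 1 (fun=> a)).
pose blk a := [:: (b, (1%N, a))] ++ map (below M 1 (fun=> a)) (levels M 0 n).
have -> : expect p (levels M 0 n.+1) (fun e' => pers n.+1 b e') e =
    1 - expect p (levels M 0 n.+1) (fun e' => \prod_(a <- index_iota 0 M) F a e') e.
  rewrite -[X in X - _](expect_cst p (levels M 0 n.+1) 1 e) -mulN1r -expectZ -expectD.
  by apply: eq_expect => e' _; rewrite mulN1r.
suff -> : expect p (levels M 0 n.+1) (fun e' => \prod_(a <- index_iota 0 M) F a e') e =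
    gw M (p * q) (1 - u).
  suff : gw M (p * q) (1 - u) <= 1 - delta by lra.
  apply: le_trans Hd; apply: gw_mono; last by lra.
    by rewrite mulr_ge0 // mulr_ile1.
  by rewrite subr_ge0.
rewrite (expect_blocks p (blk := blk)).
- have EF a : expect p (blk a) (F a) e = 1 - p * q + p * q * (1 - u).
    rewrite /blk expect_cat.
    have K e' : expect p [seq below M 1 (fun=> a) i | i <- levels M 0 n] (F a) e' =
        1 - q * (e' (b, (1%N, a)))%:R * u.
      rewrite -(uE (e' \o below M 1 (fun=> a))).
      rewrite -(@expect_map _ _ _ p (below M 1 (fun=> a)) (levels M 0 n)
         (fun e'' => pers n b e'')); last exact: below_inj.
      rewrite -[X in X - _](expect_cst p [seq below M 1 (fun=> a) i | i <- levels M 0 n] 1 e').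
      rewrite -mulNr -expectZ -expectD; apply: eq_expect => e'' He.
      rewrite /F He ?mulNr //; apply/negP => /mapP[[b' [k x]]].
      by rewrite mem_levels => /and3P[k0 _ _] [_]; lia.
    have -> : expect p [seq below M 1 (fun=> a) i | i <- levels M 0 n] (F a) =
        (fun e' => 1 - q * (e' (b, (1%N, a)))%:R * u) by apply/funext.
    by rewrite /= !upd_same /=; ring.
  under eq_bigr do rewrite EF.
  by rewrite big_const_nat subn0 iter_mulr_1.
- exact: iota_uniq.
- move=> a _ e1 e2 H; rewrite /F H ?mem_head //; congr (1 - _ * _).
  apply: supported_persist M0 _ _ _ => j jn /=; apply: H.
  by rewrite /blk mem_cat map_f ?orbT.
- move=> a a'; rewrite !mem_index_iota => /= aM aM' [b' [k x]].
  have key c : (c < M)%N -> (b', (k, x)) \in blk c -> (x %/ M ^ k.-1 = c)%N.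
    move=> cM; rewrite /blk mem_cat inE => /orP[/eqP[_ -> ->]|]; first by rewrite /= expn0 divn1.
    move=> /mapP[[b'' [k' x']]]; rewrite mem_levels => /and3P[_ _ xM] [_ -> ->] /=.
    by rewrite divnMDl ?expn_gt0 ?M0 // divn_small // addn0.
  by move=> /(key _ aM) <- /(key _ aM').
- move=> a; rewrite mem_index_iota => /= aM [b' [k x]].
  rewrite /blk mem_cat inE mem_levels => /orP[/eqP[_ -> ->]|]; first by rewrite /= expn1.
  move=> /mapP[[b'' [k' x']]]; rewrite mem_levels => /and3P[k0 kn xM] [_ -> ->] /=.
  apply/andP; split; first by lia.
  rewrite add1n expnS; exact: ltn_digit.
Qed.
End expected_persistence.

(** * From persistence to a lower bound on the dimension *)

Section covering.
Context {R : realType} (M : nat) (M1 : (2 <= M)%N) (s : R) (s0 : 0 < s).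
Implicit Types (e : node -> bool) (b : bool) (n m k x : nat).

Let M0 : (0 < M)%N. Proof. exact: ltnW. Qed.
Let Mr : 0 < M%:R :> R. Proof. by rewrite ltr0n. Qed.
Let q : R := M%:R `^ (- s).

Lemma ratio01 : 0 < q < 1.
Proof.
by rewrite /q powR_gt0 //= powRN invf_lt1 ?powR_gt0 ?powR_base_gt1.
Qed.

(** A set of diameter d is assigned a level k with M^-(k+1) <= d < M^-k, so that
    q^k is at most M^s d^s; if d = 0 any deep level will do, at the price of
    the error [eta]. *)
Lemma cover_scale (U : set R) (eta : R) : 0 < eta -> (diam U <= (2^-1)%:E)%E ->
  exists (a : R) k, [/\ 0 <= a, diam_pow s U = a%:E, q ^+ k <= M%:R `^ s * a + eta &
    forall u u', U u -> U u' -> `|u - u'| * M%:R ^+ k < 1].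
Proof.
move=> eta0 Ud; have /andP[q0 q1] := ratio01.
have q01 : 0 <= q < 1 by rewrite ltW.
have [K HK] := @exp_small R q eta q01 eta0.
have [->|/set0P U0] := eqVneq U set0.
  by exists 0, K; split => //; rewrite /diam_pow ?eqxx // mulr0 add0r HK.
have := diam_ge0 U0; case Er: (diam U) Ud => [r||] //.
rewrite !lee_fin => r2 r0.
have dU u u' : U u -> U u' -> `|u - u'| <= r.
  by move=> Uu Uu'; rewrite -lee_fin -Er; apply: ereal_sup_ubound; exists (u, u').
have EU : diam_pow s U = (r `^ s)%:E.
  by rewrite /diam_pow Er; case: eqP => // UE; case: U0 => x; rewrite UE.
move: r0; rewrite le_eqVlt => /orP[/eqP r0|r0].
  exists (r `^ s), K; split => //; first exact: powR_ge0.
    apply: (le_trans (HK _ _)) => //; rewrite lerDr mulr_ge0 ?powR_ge0 //.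
  move=> u u' Uu Uu'; have := dU u u' Uu Uu'; rewrite -r0 normr_le0 => /eqP ->.
  by rewrite normr0 mul0r ltr01.
have ex : exists k, 1 <= r * M%:R ^+ k.
  have := archi_boundP (ltW (_ : 0 < r^-1)); rewrite invr_gt0 => /(_ r0) Hk.
  exists (Num.bound r^-1); rewrite -ler_pdivrMl // mulr1; apply: (le_trans (ltW Hk)).
  by rewrite -natrX ler_nat ltnW // ltn_expl.
case: (ex_minnP ex) => -[|k] H1 Hmin; first by move: H1; rewrite expr0; lra.
exists (r `^ s), k; split => //; first exact: powR_ge0.
  apply: (@le_trans _ _ (M%:R `^ s * r `^ s)); last by rewrite lerDl ltW.
  have -> : q ^+ k = M%:R `^ s * q ^+ k.+1.
    by rewrite exprS mulrA /q powRN divff ?mul1r // gt_eqF // powR_gt0.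
  rewrite ler_wpM2l ?powR_ge0 // /q -powR_expN ?ler0n //.
  apply: ge0_ler_powR; rewrite ?nnegrE ?invr_ge0 ?exprn_ge0 ?(ltW r0) ?(ltW s0) //.
  by rewrite -div1r ler_pdivrMr // exprn_gt0.
move=> u u' Uu Uu'; apply: (@le_lt_trans _ _ (r * M%:R ^+ k)).
  by rewrite ler_wpM2r ?exprn_ge0 ?(ltW Mr) // dU.
by rewrite ltNge; apply/negP => /Hmin; rewrite ltnn.
Qed.

(** Hence the cells of level [k] met by [U] are among three consecutive ones
    around any of them. *)
Lemma cells_meeting (U : set R) k x x' :
  (forall u u', U u -> U u' -> `|u - u'| * M%:R ^+ k < 1) ->
  (exists2 u, U u & in_cell M k x u) -> (exists2 u, U u & in_cell M k x' u) ->
  (x <= x'.+1)%N.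
Proof.
move=> H [u Uu /andP[h1 h2]] [u' Uu' /andP[h3 h4]].
have := H u u' Uu Uu'; rewrite -{1}(gtr0_norm (exprn_gt0 k Mr)) -normrM mulrBl ltr_norml => /andP[g1 g2].
rewrite -ltnS -(ltr_nat R) -!natr1; lra.
Qed.

Lemma geometric_half N : \sum_(0 <= j < N) (2^-1) ^+ j.+1 <= 1 :> R.
Proof.
suff -> : \sum_(0 <= j < N) (2^-1) ^+ j.+1 = 1 - (2^-1) ^+ N :> R.
  by rewrite gerBl exprn_ge0.
elim: N => [|N IH]; first by rewrite big_nil expr0 subrr.
by rewrite big_nat_recr //= IH exprS; lra.
Qed.

(** Each set of the cover is replaced by at most three nodes of the level given
    by [cover_scale].  A branch avoiding all these nodes would lead to a point
    of the limit set outside the cover, so by [konig] the nodes form a cut of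
    some finite level, and [persist_cut] applies. *)
Lemma cover_lower_bound e b (c : R) n0 (U : nat -> set R) :
  (forall m, c <= persist M q (n0 + m) (fun v => e (b, v))) ->
  limit_set M e b `<=` \bigcup_i U i -> (forall i, (diam (U i) <= (2^-1)%:E)%E) ->
  (c%:E <= (3 * M%:R `^ s)%:E * \sum_(0 <= i <oo) diam_pow s (U i))%E.
Proof.
move=> Hc cov Ud; have /andP[q0 q1] := ratio01.
have q01 : 0 <= q <= 1 by rewrite !ltW.
apply/lee_addgt0Pr => eps eps0.
have /choice[ak Hak] : forall j : nat, exists ak : R * nat,
    [/\ 0 <= ak.1, diam_pow s (U j) = ak.1%:E,
     q ^+ ak.2 <= M%:R `^ s * ak.1 + eps / 3 * (2^-1) ^+ j.+1 &
     forall u u', U j u -> U j u' -> `|u - u'| * M%:R ^+ ak.2 < 1].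
  move=> j; have [|a [k H]] := @cover_scale (U j) (eps / 3 * (2^-1) ^+ j.+1) _ (Ud j).
    by rewrite mulr_gt0 ?divr_gt0 ?exprn_gt0.
  by exists (a, k).
pose a j := (ak j).1; pose k j := (ak j).2.
pose meets j x := exists2 u, U j u & in_cell M (k j) x u.
have /choice[ctr Hctr] : forall j, exists x0, forall x, meets j x -> meets j x0.
  move=> j; have [[x0 m0]|no] := pselect (exists x, meets j x); first by exists x0.
  by exists 0%N => x mx; case: no; exists x.
(* survivors none of whose ancestors is among the nodes assigned to the cover *)
pose bad n x := x \in survivors M e b n /\
  ~ exists j, [/\ (j <= n)%N, (k j <= n)%N & meets j (x %/ M ^ (n - k j))%N].
have badpar n x : bad n.+1 x -> bad n (x %/ M)%N.
  move=> [sx nx]; split; first exact: (survivors_parent M1 sx).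
  move=> [j [jn kn mj]]; apply: nx; exists j; split; [exact: leqW|exact: leqW|].
  by rewrite subSn // expnS divnMA.
(* an infinite branch of bad nodes would end outside the cover *)
have [n Hn] : exists n, forall x, ~ bad n x.
  apply: contrapT => Hno.
  have [||n|g Hg] := @konig _ (fun n => iota 0 (M ^ n)) (fun x => x %/ M)%N bad.
  - by move=> n x [+ _]; rewrite mem_survivors mem_iota => /andP[].
  - exact: badpar.
  - by apply: contrapT => nx; apply: Hno; exists n => x bx; apply: nx; exists x.
  have gM n : (g n < M ^ n)%N.
    by have [[+ _] _] := Hg n; rewrite mem_survivors => /andP[].
  have [z Hz] := nested_cells (R := R) M1 gM (fun n => (Hg n).2).
  have [j _ Uz] : (\bigcup_i U i) z.
    by apply: cov => n; exists (g n) => //; case: (Hg n) => [[]].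
  have gsub i m : (g (m + i) %/ M ^ i)%N = g m.
    elim: i => [|i IH]; first by rewrite addn0 divn1.
    by rewrite addnS expnS divnMA (Hg (m + i)%N).2.
  have [[_ nb] _] := Hg (maxn j (k j)); apply: nb; exists j.
  rewrite leq_maxl leq_maxr; split => //; exists z => //.
  by have := gsub (maxn j (k j) - k j)%N (k j); rewrite subnKC ?leq_maxr // => ->.
have Hn' m x : ~ bad (n + m)%N x.
  by elim: m x => [|m IH] x; [rewrite addn0|rewrite addnS => /badpar /IH].
(* the cut persists at later levels, so level n may be raised above n0 *)
pose N := (n + n0)%N.
pose L := flatten [seq [:: (k j, (ctr j).-1); (k j, ctr j); (k j, (ctr j).+1)] |
  j <- index_iota 0 N.+1].
have cut : persist M q N (fun v => e (b, v)) <= \sum_(v <- L) q ^+ v.1.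
  apply: (persist_cut M0 q01) => x sx.
  have [j [jn kn mj]] : exists j, [/\ (j <= N)%N, (k j <= N)%N & meets j (x %/ M ^ (N - k j))%N].
    by apply: contrapT => nj; apply: (Hn' n0 x); split.
  exists (k j) => //; apply/flattenP.
  exists [:: (k j, (ctr j).-1); (k j, ctr j); (k j, (ctr j).+1)].
    by apply: map_f; rewrite mem_index_iota /= ltnS.
  have [_ _ _ sm] := Hak j; have mc := Hctr j _ mj.
  have := cells_meeting sm mj mc; have := cells_meeting sm mc mj.
  set y := (x %/ _)%N; set y' := ctr j => h1 h2.
  have [|[|]] : y = y'.-1 \/ y = y' \/ y = y'.+1 by lia.
  - by move=> ->; rewrite mem_head.
  - by move=> ->; rewrite !inE eqxx orbT.
  - by move=> ->; rewrite !inE eqxx !orbT.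
have sumL : \sum_(v <- L) q ^+ v.1 = \sum_(0 <= j < N.+1) 3 * q ^+ k j.
  rewrite /L big_flatten big_map; apply: eq_bigr => j _.
  by rewrite !big_cons big_nil /=; ring.
have c_le : c <= 3 * M%:R `^ s * \sum_(0 <= j < N.+1) a j + eps.
  have := Hc n; rewrite addnC -/N => /le_trans -> //.
  apply: (le_trans cut); rewrite sumL.
  apply: (@le_trans _ _ (\sum_(0 <= j < N.+1) (3 * M%:R `^ s * a j + eps * (2^-1) ^+ j.+1))).
    apply: ler_sum => j _; have [_ _ + _] := Hak j; rewrite -/(a j) -/(k j); lra.
  rewrite big_split /= -!mulr_sumr lerD2l ler_piMr ?(ltW eps0) //.
  exact: geometric_half.
apply: (@le_trans _ _ (3 * M%:R `^ s * \sum_(0 <= j < N.+1) a j + eps)%:E).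
  by rewrite lee_fin.
rewrite EFinD EFinM leeD2r // lee_pmul2l //; last first.
  by rewrite lte_fin mulr_gt0 ?powR_gt0.
rewrite -sumEFin; under eq_bigr => j _ do (have [_ <- _ _] := Hak j).
by apply: nneseries_lim_ge => j _ _; apply: diam_pow_ge0.
Qed.

(** Diameters below 1 make the Hausdorff sums decrease with the exponent, so
    one lower bound serves all smaller exponents. *)
Lemma diam_pow_decr (s' : R) (U : set R) : 0 <= s' -> s' <= s ->
  (diam U <= (2^-1)%:E)%E -> (diam_pow s U <= diam_pow s' U)%E.
Proof.
move=> s'0 ss Ud; rewrite /diam_pow; case: ifPn => // /set0P U0.
have := diam_ge0 U0; case: (diam U) Ud => [r||] //; rewrite !lee_fin => r2 r0.
rewrite ?lee_fin; move: r0; rewrite le_eqVlt => /orP[/eqP <-|r0].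
  by rewrite powR0 ?gt_eqF // powR_ge0.
apply: ger_powR => //; apply/andP; split => //; lra.
Qed.

Lemma dimH_lower_bound e b (c : R) n0 : 0 < c ->
  (forall m, c <= persist M q (n0 + m) (fun v => e (b, v))) ->
  (s%:E <= dimH (limit_set M e b : set R))%E.
Proof.
move=> c0 Hc; apply: le_ereal_inf_tmp => _ [s' [s'0 H0] <-]; rewrite lee_fin.
rewrite leNgt; apply/negP => ss.
have kpos : 0 < 3 * M%:R `^ s by rewrite mulr_gt0 ?powR_gt0.
have : ((c / (3 * M%:R `^ s))%:E <= hausdorff_measure s' (limit_set M e b : set R))%E.
  apply: (@le_trans _ _ (hausdorff_content s' 2^-1 (limit_set M e b : set R))); last first.
    by apply: ereal_sup_ubound; exists 2^-1 => //=; rewrite invr_gt0.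
  apply: le_ereal_inf_tmp => _ [U [cov Ud] <-].
  have := cover_lower_bound Hc cov Ud.
  rewrite -lee_pdivrMl // => /le_trans h; rewrite mulrC EFinM; apply: h.
  apply: lee_nneseries => [j *|j *]; first exact: diam_pow_ge0.
  by apply: diam_pow_decr => //; apply: ltW.
by rewrite H0 lee_fin leNgt divr_gt0.
Qed.
End covering.

Section dimension_ae.
Context {d : measure_display} {T : measurableType d} {R : realType}
  (P : probability T R) (M : nat) (p : R) (Y : T -> node -> bool).
Hypotheses (p01 : 0 <= p <= 1) (hY : bernoulli_family P p (proper_node M) Y)
  (M1 : (2 <= M)%N).

(** The expected persistence is bounded below, hence persistence is bounded
    below with positive probability, hence almost surely below some survivor
    and therefore, by [persist_below], at the root. *)
Lemma dimH_ge_ae (s : R) b : 0 < s -> 1 < M%:R * p * M%:R `^ (- s) ->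
  {ae P, forall w, (forall b n, survivors M (Y w) b n != [::]) ->
    (s%:E <= dimH (limit_set M (Y w) b : set R))%E}.
Proof.
move=> s0 Mpq; have /andP[p0 p1] := p01; have M0 : (0 < M)%N by apply: ltnW.
set q := M%:R `^ (- s) in Mpq.
have /andP[q0 q1] : 0 < q < 1 by exact: ratio01.
have q01 : 0 <= q <= 1 by rewrite !ltW.
have Mp : 1 < M%:R * p by apply: (lt_le_trans Mpq); rewrite ler_piMr ?(ltW q1) // mulr_ge0.
have pq01 : 0 <= p * q <= 1 by rewrite mulr_ge0 ?mulr_ile1 // ltW.
have [||delta /andP[d0 d1] Hd] := @gw_below R M (p * q) => //; first by rewrite mulrA.
have {}Hd : gw M (p * q) (1 - delta) <= 1 - delta by apply/ltW/Hd; rewrite d0 lexx.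
have d01 : 0 <= delta <= 1 by rewrite ltW.
pose Phi m (e : node -> bool) := delta / 2 <= persist M q m (fun v => e (b, v)).
have h1 : 0 < delta / 2 by rewrite divr_gt0.
have h2 m : supported (levels M 0 m) (Phi m).
  by move=> e e' H; rewrite /Phi (supported_persist q b M0 H).
have h3 m e : Phi m.+1 e -> Phi m e.
  by rewrite /Phi => /le_trans; apply; apply: persist_decr.
have h4 m e : delta / 2 <= expect p (levels M 0 m) (fun e' => (Phi m e')%:R) e.
  have := expect_persist M0 p01 q01 m b e d01 Hd.
  suff : expect p (levels M 0 m) (fun e' => persist M q m (fun v => e' (b, v))) e <=
     expect p (levels M 0 m) (fun e' => (Phi m e')%:R + delta / 2) e.
    by rewrite expectD expect_cst; lra.
  apply: ler_expect => // e' _; rewrite /Phi.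
  have /andP[_ f1] := persist01 M q01 m (fun v => e' (b, v)).
  case: (leP (delta / 2)) => h /=; last by rewrite add0r ltW.
  by rewrite (le_trans f1) // lerDl ltW.
have := zero_one_ae p01 hY M1 Mp h1 h2 h3 h4.
apply: filterS => w H /H[n [y [Hy HPhi]]].
have := Hy b; rewrite mem_survivors => /andP[ay yM].
apply: (@dimH_lower_bound _ _ M1 s s0 _ _ (q ^+ n * (delta / 2)) n).
  by rewrite mulr_gt0 ?exprn_gt0.
move=> m; apply: le_trans (persist_below M0 q01 m yM ay).
by rewrite ler_wpM2l ?exprn_ge0 ?(ltW q0) //; apply: HPhi.
Qed.
End dimension_ae.

(** * The dimension compared with one half *)

Section critical_exponent.
Context {R : realType} (M : nat) (p : R).
Hypotheses (M1 : (2 <= M)%N) (p01 : 0 <= p <= 1).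

Let Mr : 1 < M%:R :> R. Proof. by rewrite ltr1n. Qed.

(** The threshold [M * p ^+ 2 = 1] is the threshold [log (M p) / log M = 1 / 2].
    Squaring avoids logarithms. *)
Lemma sq_power_half (s : R) : (M%:R * p * M%:R `^ (- s)) ^+ 2 =
  M%:R * p ^+ 2 * (M%:R `^ (1 / 2 - s)) ^+ 2.
Proof.
have M0 : 0 < M%:R :> R by apply: lt_trans Mr.
have -> : (M%:R `^ (1 / 2 - s)) ^+ 2 = M%:R * (M%:R `^ (- s)) ^+ 2 :> R.
  rewrite powRD; last by rewrite (gt_eqF M0) implybT.
  rewrite exprMn -[in LHS](powR_mulrn 2 (powR_ge0 _ (1 / 2))) -powRrM.
  by have -> : 1 / 2 * 2%:R = 1 :> R; [lra|rewrite powRr1 // ltW].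
by rewrite !exprMn; ring.
Qed.

Lemma supercritical_below (s : R) : 1 <= M%:R * p ^+ 2 -> s < 1 / 2 ->
  1 < M%:R * p * M%:R `^ (- s).
Proof.
move=> Mpp s2; have /andP[p0 _] := p01.
have h0 : 0 <= M%:R * p * M%:R `^ (- s) by rewrite !mulr_ge0 ?powR_ge0.
rewrite -(ltr_pXn2r (ltn0Sn 1)) ?nnegrE // expr1n sq_power_half.
have h : 1 < M%:R `^ (1 / 2 - s) by apply: powR_base_gt1; rewrite ?subr_gt0.
apply: (@lt_le_trans _ _ ((M%:R `^ (1 / 2 - s)) ^+ 2)); first by rewrite exprn_egt1.
by rewrite ler_peMl // exprn_ge0 // powR_ge0.
Qed.

Lemma subcritical_above (s : R) : M%:R * p ^+ 2 <= 1 -> 1 / 2 < s ->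
  M%:R * p * M%:R `^ (- s) < 1.
Proof.
move=> Mpp s2; have /andP[p0 _] := p01.
have h0 : 0 <= M%:R * p * M%:R `^ (- s) by rewrite !mulr_ge0 ?powR_ge0.
rewrite -(ltr_pXn2r (ltn0Sn 1)) ?nnegrE // expr1n sq_power_half.
have h : M%:R `^ (1 / 2 - s) < 1.
  rewrite -[1 / 2 - s]opprB powRN invf_lt1 ?powR_gt0 ?powR_base_gt1 ?subr_gt0 //.
  exact: lt_trans Mr.
apply: (@le_lt_trans _ _ ((M%:R `^ (1 / 2 - s)) ^+ 2)).
  by rewrite ler_piMl // exprn_ge0 // powR_ge0.
by rewrite exprn_ilt1 // powR_ge0.
Qed.
End critical_exponent.

Section percolation_dimension.
Context {d : measure_display} {T : measurableType d} {R : realType}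
  (P : probability T R) (M : nat) (p : R) (Y : T -> node -> bool).
Hypotheses (p01 : 0 <= p <= 1) (hY : bernoulli_family P p (proper_node M) Y)
  (M1 : (2 <= M)%N).

Lemma dimH_ge_half_ae b : 1 <= M%:R * p ^+ 2 ->
  {ae P, forall w, (forall b n, survivors M (Y w) b n != [::]) ->
    ((1 / 2 : R)%:E <= dimH (limit_set M (Y w) b : set R))%E}.
Proof.
move=> Mpp; pose s (k : nat) : R := 1 / 2 - (k.+3%:R)^-1.
have sk k : 0 < ((k.+3%:R)^-1 : R) < 1 / 2.
  by rewrite invr_gt0 ltr0n /= div1r ltf_pV2 ?posrE ?ltr0n // ltr_nat.
have H k : {ae P, forall w, (forall b n, survivors M (Y w) b n != [::]) ->
    ((s k)%:E <= dimH (limit_set M (Y w) b : set R))%E}.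
  have /andP[k0 k1] := sk k.
  apply: (dimH_ge_ae p01 hY M1); first by rewrite subr_gt0.
  by apply: (supercritical_below M1 p01 Mpp); rewrite /s gtrBl.
have := ae_foralln H; apply: filterS => w Hw surv; apply/lee_addgt0Pr => eps eps0.
have [k Hk] := le_inv_nat eps0.
have -> : 1 / 2 = s k + (k.+3%:R)^-1 by rewrite /s subrK.
rewrite EFinD; apply: leeD; first exact: Hw.
by rewrite lee_fin (le_trans _ Hk) // lef_pV2 ?posrE ?ltr0n // ler_nat; lia.
Qed.

Lemma dimH_le_half_ae b : M%:R * p ^+ 2 <= 1 ->
  {ae P, forall w, (dimH (limit_set M (Y w) b : set R) <= (1 / 2 : R)%:E)%E}.
Proof.
move=> Mpp; pose s (k : nat) : R := 1 / 2 + (k.+1%:R)^-1.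
have sk k : 0 < (k.+1%:R)^-1 :> R by rewrite invr_gt0 ltr0n.
have s0 k : 0 <= s k by rewrite addr_ge0 // ltW.
have H k : {ae P, forall w, hausdorff_measure (s k) (limit_set M (Y w) b : set R) = 0%E}.
  apply: (hausdorff_measure0_ae p01 hY M1) => //.
  by apply: (subcritical_above M1 p01 Mpp); rewrite ltrDl.
have := ae_foralln H; apply: filterS => w Hw; apply/lee_addgt0Pr => eps eps0.
have [k Hk] := le_inv_nat eps0.
apply: (@le_trans _ _ (s k)%:E); last by rewrite -EFinD lee_fin lerD2l.
by apply: ereal_inf_lbound; exists (s k).
Qed.
End percolation_dimension.

Theorem corollary1 (R : realType) (d : measure_display) (T : measurableType d)
    (P : probability T R) (M : nat) (p : R)
    (X1 X2 : seq 'I_M -> {RV P >-> bool})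
    (hM : (2 <= M)%N) (hp : 0 <= p <= 1) (hMp : 1 < M%:R * p)
    (hX1 : percolation_labels p X1) (hX2 : percolation_labels p X2)
    (hX12 : independent_families strings X1 X2) :
  let F1 : T -> set R := percolation_set X1 in
  let F2 : T -> set R := percolation_set X2 in
  {ae P, forall w, F1 w !=set0 -> F2 w !=set0 ->
     (dimH (F1 w) + dimH (F2 w) < 1)%E ->
     ~ contains_interval (algebraic_difference (F2 w) (F1 w))} /\
  {ae P, forall w, F1 w !=set0 -> F2 w !=set0 ->
     (1 < dimH (F1 w) + dimH (F2 w))%E ->
     contains_interval (algebraic_difference (F2 w) (F1 w))}.
Proof.
move=> F1 F2.
pose Y := node_label (ltnW hM) X1 X2.
have hY : bernoulli_family P p (proper_node M) Y by exact: node_label_bernoulli.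
have F1E w : F1 w = limit_set M (Y w) false by exact: (percolation_setE hM X1 X2 false).
have F2E w : F2 w = limit_set M (Y w) true by exact: (percolation_setE hM X1 X2 true).
have surv w : F1 w !=set0 -> F2 w !=set0 -> forall b n, survivors M (Y w) b n != [::].
  rewrite F1E F2E => -[z1 H1] [z2 H2] [] n; [move: (H2 n)|move: (H1 n)];
    by case=> x; case: (survivors _ _ _ _).
have half2 : (1 / 2 : R)%:E + (1 / 2 : R)%:E = 1%E :> \bar R.
  by rewrite -EFinD; congr (_%:E); lra.
split.
- case: (ltP (M%:R * p ^+ 2) 1) => Mpp.
    have := no_interval_ae hp hY hM Mpp; apply: filterS => w H _ _ _ [a [b [ab sub]]].
    apply: (H a b ab) => z zab.
    have [|x2 Hx2 [x1 Hx1 <-]] := sub z; first by rewrite /= in_itv.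
    by exists x1, x2; rewrite -F1E -F2E.
  have := dimH_ge_half_ae hp hY hM false Mpp; have := dimH_ge_half_ae hp hY hM true Mpp.
  apply: filterS2 => w H2 H1 n1 n2 + _; rewrite ltNge => /negP; apply.
  by rewrite F1E F2E -half2; apply: leeD; [apply: H1|apply: H2]; apply: surv.
case: (leP (M%:R * p ^+ 2) 1) => Mpp.
  have := dimH_le_half_ae hp hY hM false Mpp; have := dimH_le_half_ae hp hY hM true Mpp.
  apply: filterS2 => w H2 H1 _ _; rewrite ltNge => /negP; case.
  by rewrite F1E F2E -half2; apply: leeD.
have := interval_ae hp hY hM Mpp; apply: filterS => w H n1 n2 _.
have [a [c [ac Hac]]] := H (surv w n1 n2).
exists a, c; split => // u; rewrite /= in_itv /= => /Hac[z1 [z2 [h1 h2 ->]]].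
by exists z2; [rewrite F2E|exists z1; rewrite ?F1E].
Qed.
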